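(* Let $\mathcal{I},\mathcal{J}$ be operator ideals, let $\mathcal{C}$ be a class of Banach spaces, let $\tau$ be a $\mathcal{C}$-projective ideal topology, $n\in\mathbb{N}$ and $E\in\mathcal{C}$. Consider the following conditions: (a) $\widehat{\otimes}^{n}_{s,\pi}E$ has the $(\mathcal{I},\mathcal{J},\tau)$-WAP. (b) $\mathcal{I}\circ\mathcal{P}\left(^nE;\widehat{\otimes}^{n}_{s,\pi}E\right)\subseteq\overline{\mathcal{J}\circ\mathcal{P}\left(^nE;\widehat{\otimes}^{n}_{s,\pi}E\right)}^{\,\tau}$. (c) $\mathcal{I}\left(E;\widehat{\otimes}^{n}_{s,\pi}E\right)\subseteq\overline{\mathcal{J}\left(E;\widehat{\otimes}^{n}_{s,\pi}E\right)}^{\,\tau}$. Then (a) and (b) are equivalent and they imply (c).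
   Context: All Banach spaces are over $\mathbb{K}=\mathbb{R}$ or $\mathbb{C}$; $\mathrm{BAN}$ is the class of all of them. $\mathcal{L}(E;F)$, $\mathcal{L}(E_1,\dots,E_n;F)$ and $\mathcal{P}(^nE;F)$ are the spaces of bounded linear operators, continuous $n$-linear mappings and continuous $n$-homogeneous polynomials. $E_1\widehat\otimes_\pi\cdots\widehat\otimes_\pi E_n$ is the completed projective tensor product and $\widehat\otimes^n_{s,\pi}E$ the completed $n$-fold symmetric projective tensor product; $\otimes^n x=x\otimes\cdots\otimes x$. The linearizations of $A\in\mathcal{L}(E_1,\dots,E_n;F)$ and $P\in\mathcal{P}(^nE;F)$ are the bounded operators $A_L$ on $E_1\widehat\otimes_\pi\cdots\widehat\otimes_\pi E_n$ and $P_L$ on $\widehat\otimes^n_{s,\pi}E$ with $A_L(x_1\otimes\cdots\otimes x_n)=A(x_1,\dots,x_n)$ and $P_L(\otimes^n x)=P(x)$. Operator ideals are in the sense of Pietsch: each component $\mathcal{I}(E;F)$ is a linear subspace of $\mathcal{L}(E;F)$ containing the finite rank operators, and $w\circ v\circ u\in\mathcal{I}$ whenever $v\in\mathcal{I}$ and $u,w$ are bounded operators. $\mathcal{I}\circ\mathcal{P}(^nE;F)$ is the set of $P\in\mathcal{P}(^nE;F)$ of the form $P=u\circ Q$ with $G$ a Banach space, $Q\in\mathcal{P}(^nE;G)$ and $u\in\mathcal{I}(G;F)$. An ideal topology $\tau$ assigns to each $\mathcal{L}(E;F)$ ($E,F$ Banach spaces) a linear topology, still denoted $\tau$, such that for every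 operator ideal $\mathcal{I}$ the class $\overline{\mathcal{I}}^{\,\tau}$ with components $\overline{\mathcal{I}}^{\,\tau}(E;F):=\overline{\mathcal{I}(E;F)}^{\,\tau}$ ($\tau$-closure in $\mathcal{L}(E;F)$) is an operator ideal. For a class $\mathcal{C}\subseteq\mathrm{BAN}$, a $\mathcal{C}$-projective ideal topology $\tau$ assigns, for all $n\in\mathbb{N}$ and all Banach spaces, a linear topology, still denoted $\tau$, to each of the spaces $\mathcal{L}(E;F)$, $\mathcal{P}(^nE;F)$, $\mathcal{L}(E_1,\dots,E_n;F)$ such that: (i) restricted to the spaces $\mathcal{L}(E;F)$, $\tau$ is an ideal topology; (ii) for all $n$ and Banach spaces $E,E_1,\dots,E_n,F$ with $E$ and at least one of the $E_j$ belonging to $\mathcal{C}$, the linear bijections $P\in(\mathcal{P}(^nE;F),\tau)\mapsto P_L\in(\mathcal{L}(\widehat\otimes^n_{s,\pi}E;F),\tau)$ and $A\in(\mathcal{L}(E_1,\dots,E_n;F),\tau)\mapsto A_L\in(\mathcal{L}(E_1\widehat\otimes_\pi\cdots\widehat\otimes_\pi E_n;F),\tau)$ are homeomorphisms. A Banach space $X$ has the $(\mathcal{I},\mathcal{J},\tau)$-weak approximation property ($(\mathcal{I},\mathcal{J},\tau)$-WAP) if $\mathcal{I}(X;X)\subseteq\overline{\mathcal{J}(X;X)}^{\,\tau}$. *)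

(* Defs.v *)
From HB Require Import structures.
From mathcomp Require Import all_boot all_order all_algebra.
From mathcomp Require Import complex.
From mathcomp Require Import all_classical all_reals.
From mathcomp Require Import topology normedtype sequences.
From mathcomp Require Import interval_inference ring lra.

Set Implicit Arguments.
Unset Strict Implicit.
Unset Printing Implicit Defensive.

Import Order.TTheory GRing.Theory Num.Theory.
Import numFieldNormedType.Exports.

Local Open Scope quotient_scope.
Local Open Scope classical_set_scope.
Local Open Scope ring_scope.

Inductive scalars := RealScalars of realType | ComplexScalars of realType.

Definition real_part_field (K : scalars) : realType :=
  match K with RealScalars R => R | ComplexScalars R => R end.

Definition scalar_field (K : scalars) : numFieldType :=
  match K with RealScalars R => R | ComplexScalars R => R[i] end.

Coercion scalar_field : scalars >-> numFieldType.

Notation "K ^re" := (real_part_field K) (at level 2, format "K ^re").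

Definition toC (K : scalars) : K^re -> K :=
  match K return K^re -> K with
  | RealScalars _ => id
  | ComplexScalars _ => fun r => Complex r 0
  end.

Definition toR (K : scalars) : K -> K^re :=
  match K return K -> K^re with
  | RealScalars _ => id
  | ComplexScalars _ => fun z => complex.Re z
  end.

Arguments toC {K}.
Arguments toR {K}.

Section ScalarTheory.
Context {K : scalars}.

Lemma toCK : cancel (@toC K) toR.
Proof. by case: K. Qed.

Lemma toRK (x : K) : 0 <= x -> toC (toR x) = x.
Proof.
by case: K x => R //= [a b]; rewrite lecE /= => /andP[/eqP -> _].
Qed.

Lemma toRD (x y : K) : toR (x + y) = toR x + toR y.
Proof. by case: K x y => R //= [a b] [c d]. Qed.

Lemma toR0 : toR (0 : K) = 0.
Proof. by case: K. Qed.

Lemma toR1 : toR (1 : K) = 1.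
Proof. by case: K. Qed.

Lemma toC0 : toC (0 : K^re) = 0.
Proof. by case: K. Qed.

Lemma toC1 : toC (1 : K^re) = 1.
Proof. by case: K. Qed.

Lemma toCD (x y : K^re) : toC (x + y) = toC x + toC y.
Proof. by case: K x y => R //= x y; rewrite -[RHS]/(Complex _ _) addr0. Qed.

Lemma toCM (x y : K^re) : toC (x * y) = toC x * toC y.
Proof.
case: K x y => R //= x y; rewrite -[RHS]/(Complex _ _).
by rewrite !mulr0 mul0r subr0 addr0.
Qed.

Lemma toC_le (x y : K^re) : (toC x <= toC y) = (x <= y).
Proof. by case: K x y => R //= x y; rewrite lecE /= eqxx. Qed.

Lemma toC_lt (x y : K^re) : (toC x < toC y) = (x < y).
Proof. by case: K x y => R //= x y; rewrite ltcE /= eqxx. Qed.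

Lemma toC_inj : injective (@toC K).
Proof. exact: can_inj toCK. Qed.

Lemma toR_le (x y : K) : x <= y -> toR x <= toR y.
Proof. by case: K x y => R //= x y; rewrite lecE => /andP[]. Qed.

Lemma toR_ge0 (x : K) : 0 <= x -> 0 <= toR x.
Proof. by rewrite -toR0; exact: toR_le. Qed.

Lemma toRM (x y : K) : 0 <= x -> 0 <= y -> toR (x * y) = toR x * toR y.
Proof.
by move=> x0 y0; apply: toC_inj; rewrite toCM !toRK // mulr_ge0.
Qed.

Lemma toR_gt0 (x : K) : 0 < x -> 0 < toR x.
Proof. by move=> x0; rewrite -toC_lt toC0 toRK // ltW. Qed.

Lemma natSinv_lt (R : realType) (e : R) : 0 < e ->
  exists N, forall n, (N <= n)%N -> n.+1%:R^-1 < e.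
Proof.
move=> /posnumP[d]; have [N _ hN] := near_infty_natSinv_lt d.
by exists N => n; exact: hN.
Qed.

End ScalarTheory.

Notation banach K := (completeNormedModType K).

Record seminorm (K : scalars) (V : lmodType K) := Seminorm {
  seminorm_fun :> V -> K^re;
  seminorm_triangle : forall x y, seminorm_fun (x + y) <= seminorm_fun x + seminorm_fun y;
  seminormZ : forall (a : K) x, seminorm_fun (a *: x) = toR `|a| * seminorm_fun x
}.

Section SeminormTheory.
Context (K : scalars) (V : lmodType K) (p : seminorm V).

Lemma seminorm0 : p 0 = 0.
Proof. by rewrite -(scale0r 0) seminormZ normr0 toR0 mul0r. Qed.

Lemma seminormN x : p (- x) = p x.
Proof. by rewrite -scaleN1r seminormZ normrN1 toR1 mul1r. Qed.

Lemma seminormC x y : p (x - y) = p (y - x).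
Proof. by rewrite -seminormN opprB. Qed.

Lemma seminorm_ge0 x : 0 <= p x.
Proof.
have := seminorm_triangle p x (- x).
by rewrite subrr seminorm0 seminormN -mulr2n pmulrn_lge0.
Qed.

Lemma seminorm_dist x y : `|p x - p y| <= p (x - y).
Proof.
rewrite ler_norml lerNl opprB !lerBlDr; apply/andP; split.
  by rewrite seminormC -{1}(subrK x y); exact: seminorm_triangle.
by rewrite -{1}(subrK y x); exact: seminorm_triangle.
Qed.

Lemma seminorm_ker0 x y : p (x - y) = 0 -> p x = p y.
Proof.
move=> h; apply/eqP; rewrite -subr_eq0 -normr_le0 -h; exact: seminorm_dist.
Qed.

End SeminormTheory.

Section Separation.
Context (K : scalars) (V : lmodType K) (p : seminorm V).

Definition seminorm_equiv : rel V := fun x y => p (x - y) == 0.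

Lemma seminorm_equiv_refl : reflexive seminorm_equiv.
Proof. by move=> x; rewrite /seminorm_equiv subrr seminorm0. Qed.

Lemma seminorm_equiv_sym : symmetric seminorm_equiv.
Proof. by move=> x y; rewrite /seminorm_equiv seminormC. Qed.

Lemma seminorm_equiv_trans : transitive seminorm_equiv.
Proof.
move=> y x z /eqP xy /eqP yz; rewrite /seminorm_equiv eq_le seminorm_ge0 andbT.
rewrite -(subrK y x) -addrA; apply: le_trans (seminorm_triangle _ _ _) _.
by rewrite xy yz addr0.
Qed.

Canonical seminorm_equiv_rel :=
  EquivRel seminorm_equiv seminorm_equiv_refl seminorm_equiv_sym
    seminorm_equiv_trans.

Definition separation := {eq_quot seminorm_equiv}.
HB.instance Definition _ := EqQuotient.on separation.
HB.instance Definition _ := Choice.on separation.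

Definition sep_class (x : V) : separation := \pi x.

Lemma sep_classP x y : sep_class x = sep_class y <-> p (x - y) = 0.
Proof.
rewrite /sep_class; split=> [/eqmodP/eqP //|h].
by apply/eqmodP/eqP.
Qed.

Lemma sep_ind (P : separation -> Prop) :
  (forall x, P (sep_class x)) -> forall z, P z.
Proof. by move=> h z; rewrite -[z]reprK; exact: h. Qed.

Lemma sep_repr x : p (repr (sep_class x) - x) = 0.
Proof. by apply/sep_classP; rewrite /sep_class reprK. Qed.

Definition sep_zero := sep_class 0.
Definition sep_add (z t : separation) := sep_class (repr z + repr t).
Definition sep_opp (z : separation) := sep_class (- repr z).
Definition sep_scale (a : K) (z : separation) := sep_class (a *: repr z).
Definition sep_norm (z : separation) : K := toC (p (repr z)).

Lemma sep_addE x y : sep_add (sep_class x) (sep_class y) = sep_class (x + y).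
Proof.
apply/sep_classP/eqP; rewrite eq_le seminorm_ge0 andbT opprD addrACA.
apply: le_trans (seminorm_triangle _ _ _) _.
by rewrite !sep_repr addr0.
Qed.

Lemma sep_oppE x : sep_opp (sep_class x) = sep_class (- x).
Proof. by apply/sep_classP; rewrite -opprD seminormN sep_repr. Qed.

Lemma sep_scaleE a x : sep_scale a (sep_class x) = sep_class (a *: x).
Proof. by apply/sep_classP; rewrite -scalerBr seminormZ sep_repr mulr0. Qed.

Lemma sep_normE x : sep_norm (sep_class x) = toC (p x).
Proof. by congr toC; apply: seminorm_ker0; exact: sep_repr. Qed.

Lemma sep_addA : associative sep_add.
Proof. by do 3!elim/sep_ind => ?; rewrite !sep_addE addrA. Qed.

Lemma sep_addC : commutative sep_add.
Proof. by do 2!elim/sep_ind => ?; rewrite !sep_addE addrC. Qed.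

Lemma sep_add0 : left_id sep_zero sep_add.
Proof. by elim/sep_ind => ?; rewrite sep_addE add0r. Qed.

Lemma sep_addN : left_inverse sep_zero sep_opp sep_add.
Proof. by elim/sep_ind => ?; rewrite sep_oppE sep_addE addNr. Qed.

HB.instance Definition _ :=
  GRing.isZmodule.Build separation sep_addA sep_addC sep_add0 sep_addN.

Lemma sep_scaleA a b z : sep_scale a (sep_scale b z) = sep_scale (a * b) z.
Proof. by elim/sep_ind: z => x; rewrite !sep_scaleE scalerA. Qed.

Lemma sep_scale1 : left_id 1 sep_scale.
Proof. by elim/sep_ind => x; rewrite sep_scaleE scale1r. Qed.

Lemma sep_scaleDr : right_distributive sep_scale +%R.
Proof.
move=> a; do 2!elim/sep_ind => ?.
by rewrite /GRing.add /= !(sep_scaleE, sep_addE) scalerDr.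
Qed.

Lemma sep_scaleDl z : {morph sep_scale^~ z : a b / a + b}.
Proof.
elim/sep_ind: z => x a b.
by rewrite [in RHS]/GRing.add /= !(sep_scaleE, sep_addE) scalerDl.
Qed.

HB.instance Definition _ := GRing.Zmodule_isLmodule.Build K separation
  sep_scaleA sep_scale1 sep_scaleDr sep_scaleDl.

Lemma sep_classD x y : sep_class (x + y) = sep_class x + sep_class y.
Proof. by rewrite -sep_addE. Qed.

Lemma sep_classN x : sep_class (- x) = - sep_class x.
Proof. by rewrite -sep_oppE. Qed.

Lemma sep_classZ a x : sep_class (a *: x) = a *: sep_class x.
Proof. by rewrite -sep_scaleE. Qed.

Lemma sep_norm_triangle z t : sep_norm (z + t) <= sep_norm z + sep_norm t.
Proof.
elim/sep_ind: z => x; elim/sep_ind: t => y.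
by rewrite -sep_classD !sep_normE -toCD toC_le seminorm_triangle.
Qed.

Lemma sep_normZ a z : sep_norm (a *: z) = `|a| * sep_norm z.
Proof.
elim/sep_ind: z => x.
by rewrite -sep_classZ !sep_normE seminormZ toCM toRK.
Qed.

Lemma sep_norm_eq0 z : sep_norm z = 0 -> z = 0.
Proof.
elim/sep_ind: z => x; rewrite sep_normE -toC0 => /toC_inj h.
by apply/sep_classP; rewrite subr0.
Qed.

HB.instance Definition _ := Lmodule_isNormed.Build K separation
  sep_norm_triangle sep_normZ sep_norm_eq0.

Lemma norm_sep_class x : `|sep_class x| = toC (p x).
Proof. exact: sep_normE. Qed.

Lemma separation_extend (F : normedModType K) (f : {linear V -> F}) (C : K^re) :
  (forall x, `|f x| <= toC (C * p x)) ->
  exists g : separation -> F,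
    [/\ linear g, continuous g & forall x, g (sep_class x) = f x].
Proof.
move=> fC; pose g (z : separation) := f (repr z).
have gE x : g (sep_class x) = f x.
  apply/eqP; rewrite -subr_eq0 -raddfB -normr_le0; apply: le_trans (fC _) _.
  by rewrite sep_repr mulr0 toC0.
have glin : linear g.
  move=> a; do 2!elim/sep_ind => ?.
  by rewrite -sep_classZ -sep_classD !gE linearP.
exists g; split=> //.
pose g' : {linear separation -> F} :=
  HB.pack g (GRing.isLinear.Build K separation F _ g glin).
apply: (@bounded_linear_continuous _ _ _ g').
apply/linear_boundedP; near=> r => /=.
elim/sep_ind => x; rewrite norm_sep_class /= gE; apply: le_trans (fC _) _.
rewrite toCM ler_wpM2r -?toC0 ?toC_le ?seminorm_ge0 //.
by near: r; apply: nbhs_pinfty_ge; case: (K) (C) => R c /=; rewrite ?num_real // realE !lecE /= eqxx /= le_total.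
Unshelve. all: by end_near. Qed.

End Separation.

Section Completion.
Context (K : scalars) (V : lmodType K) (p : seminorm V).

Definition seminorm_cauchy (u : nat -> V) : Prop :=
  forall e : K^re, 0 < e ->
  exists N, forall m n, (N <= m)%N -> (N <= n)%N -> p (u m - u n) < e.

Definition cauchy_pred : {pred nat -> V} := mem [set u | seminorm_cauchy u].

Lemma cauchy_submod_closed : submod_closed cauchy_pred.
Proof.
split.
  rewrite inE => e e0; exists 0%N => m n _ _.
  by rewrite /GRing.zero /= subrr seminorm0.
move=> a u v; rewrite !inE => cu cv e e0.
have c0 : 0 < toR `|a| + 1 by rewrite ltr_wpDl // toR_ge0.
have [|N1 h1] := cu (e / 2 / (toR `|a| + 1)); first by rewrite !divr_gt0.
have [|N2 h2] := cv (e / 2); first by rewrite divr_gt0.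
exists (maxn N1 N2) => m n; rewrite !geq_max => /andP[m1 m2] /andP[n1 n2].
rewrite [X in p X](_ : _ = a *: (u m - u n) + (v m - v n)); last first.
  by rewrite scalerBr opprD addrACA.
apply: le_lt_trans (seminorm_triangle _ _ _) _.
rewrite [ltRHS]splitr ler_ltD ?h2 // seminormZ.
apply: le_trans (ler_wpM2l _ (ltW (h1 m n m1 n1))) _; first exact: toR_ge0.
rewrite mulrA ler_pdivrMr // mulrC ler_pM2l ?divr_gt0 //.
by rewrite lerDl.
Qed.

HB.instance Definition _ :=
  GRing.isSubmodClosed.Build K (nat -> V) cauchy_pred cauchy_submod_closed.

Record cauchy_sequence := CauchySequence {
  cauchy_sequence_val :> nat -> V; _ : cauchy_sequence_val \in cauchy_pred }.

HB.instance Definition _ := [isSub for cauchy_sequence_val].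
HB.instance Definition _ := [Choice of cauchy_sequence by <:].
HB.instance Definition _ := [SubChoice_isSubLmodule of cauchy_sequence by <:].

Lemma cauchy_sequenceP (u : cauchy_sequence) : seminorm_cauchy u.
Proof. by have := valP u; rewrite inE. Qed.

Lemma cauchy_sequenceD (u v : cauchy_sequence) n : (u + v) n = u n + v n.
Proof. by rewrite [(u + v : nat -> V)](raddfD (val : cauchy_sequence -> (nat -> V))). Qed.

Lemma cauchy_sequenceN (u : cauchy_sequence) n : (- u) n = - u n.
Proof. by rewrite [(- u : nat -> V)](raddfN (val : cauchy_sequence -> (nat -> V))). Qed.

Lemma cauchy_sequenceZ a (u : cauchy_sequence) n : (a *: u) n = a *: u n.
Proof. by rewrite [(a *: u : nat -> V)](linearZZ (val : {linear cauchy_sequence -> (nat -> V)})). Qed.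

Definition cauchy_norm (u : cauchy_sequence) : K^re :=
  limn (fun n => p (u n)).

Lemma cauchy_norm_cvg (u : cauchy_sequence) :
  (fun n => p (u n)) @ \oo --> cauchy_norm u.
Proof.
apply/cauchy_cvgP/cauchy_exP => e e0.
have [N hN] := cauchy_sequenceP u e0.
exists (p (u N)); exists N => //= n /= Nn.
by rewrite -ball_normE /=; apply: le_lt_trans (seminorm_dist _ _ _) (hN _ _ _ _).
Qed.

Lemma cauchy_norm_eq (u : cauchy_sequence) (l : K^re) :
  (fun n => p (u n)) @ \oo --> l -> cauchy_norm u = l.
Proof. by move=> h; apply/cvg_lim. Qed.

Lemma cauchy_normD (u v : cauchy_sequence) :
  cauchy_norm (u + v) <= cauchy_norm u + cauchy_norm v.
Proof.
apply: (ler_cvg_to (@cauchy_norm_cvg (u + v))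
  (cvgD (@cauchy_norm_cvg u) (@cauchy_norm_cvg v))).
by near=> n; rewrite cauchy_sequenceD; exact: seminorm_triangle.
Unshelve. all: by end_near. Qed.

Lemma cauchy_normZ a (u : cauchy_sequence) :
  cauchy_norm (a *: u) = toR `|a| * cauchy_norm u.
Proof.
apply: cauchy_norm_eq.
rewrite (_ : (fun n => _) = (fun n => toR `|a| * p (u n))); last first.
  by apply/funext => n; rewrite cauchy_sequenceZ seminormZ.
exact: cvgMr (@cauchy_norm_cvg u).
Qed.

Definition cauchy_seminorm : seminorm cauchy_sequence :=
  Seminorm cauchy_normD cauchy_normZ.

Definition completion := separation cauchy_seminorm.
HB.instance Definition _ := NormedModule.on completion.

Lemma cst_seminorm_cauchy (x : V) : (fun=> x) \in cauchy_pred.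
Proof.
rewrite inE => e e0; exists 0%N => m n _ _.
by rewrite subrr seminorm0.
Qed.

Definition completion_in (x : V) : completion :=
  sep_class cauchy_seminorm (CauchySequence (cst_seminorm_cauchy x)).

Lemma completion_inD x y :
  completion_in (x + y) = completion_in x + completion_in y.
Proof.
rewrite /completion_in -sep_classD; congr sep_class.
by apply/val_inj/funext => n; rewrite [RHS]cauchy_sequenceD.
Qed.

Lemma completion_inZ a x : completion_in (a *: x) = a *: completion_in x.
Proof.
rewrite /completion_in -sep_classZ; congr sep_class.
by apply/val_inj/funext => n; rewrite [RHS]cauchy_sequenceZ.
Qed.

Lemma completion_inB x y :
  completion_in (x - y) = completion_in x - completion_in y.
Proof. by rewrite completion_inD -scaleN1r completion_inZ scaleN1r. Qed.

Lemma norm_completion_in x : `|completion_in x| = toC (p x).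
Proof.
rewrite norm_sep_class; congr toC; apply: cauchy_norm_eq; exact: (@cvg_cst _ (p x) nat \oo _).
Qed.

Lemma dist_completion (u : cauchy_sequence) (e : K^re) N :
  (forall n, (N <= n)%N -> p (u N - u n) <= e) ->
  `|completion_in (u N) - sep_class cauchy_seminorm u| <= toC e.
Proof.
move=> h; rewrite /completion_in -sep_classN -sep_classD norm_sep_class toC_le.
apply: (ler_cvg_to (@cauchy_norm_cvg _) (cvg_cst e)).
by exists N => // n /= /h; rewrite cauchy_sequenceD cauchy_sequenceN.
Qed.

Lemma completion_dense (z : completion) (e : K^re) : 0 < e ->
  exists x, `|completion_in x - z| <= toC e.
Proof.
move=> e0; elim/sep_ind: z => u.
have [N hN] := cauchy_sequenceP u e0.
by exists (u N); apply: dist_completion => n Nn; exact/ltW/hN.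
Qed.

Lemma completion_cauchy_cvg (F : set_system completion) :
  ProperFilter F -> cauchy F -> cvg F.
Proof.
move=> FF /cauchyP Fc.
have /choice[v hv] (n : nat) : exists x : V,
    F [set z | `|completion_in x - z| < toC (n.+1%:R^-1)].
  have e0 : 0 < n.+1%:R^-1 / 2 :> K^re by rewrite divr_gt0 // invr_gt0.
  have [z Fz] := Fc (toC (n.+1%:R^-1 / 2)) (ltac:(by rewrite -toC0 toC_lt)).
  have [x xz] := completion_dense z e0.
  exists x; apply: filterS Fz => t; rewrite -ball_normE /= => zt.
  rewrite -(subrK z (completion_in x)) -addrA.
  apply: le_lt_trans (ler_normD _ _) _.
  by rewrite [X in _ < toC X]splitr toCD ler_ltD.
have vd (m n : nat) : p (v m - v n) < m.+1%:R^-1 + n.+1%:R^-1.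
  have /filter_ex[z [/= h1 h2]] : F
    ([set z | `|completion_in (v m) - z| < toC m.+1%:R^-1] `&`
     [set z | `|completion_in (v n) - z| < toC n.+1%:R^-1]) by apply: filterI.
  rewrite -toC_lt -norm_completion_in completion_inB toCD.
  rewrite -(subrK z (completion_in (v m))) -addrA.
  apply: le_lt_trans (ler_normD _ _) _.
  by rewrite ltrD // distrC.
have cv : v \in cauchy_pred.
  rewrite inE => e e0.
  have e20 : 0 < e / 2 by rewrite divr_gt0.
  have [N hN] := natSinv_lt e20.
  exists N => m n Nm Nn; apply: lt_trans (vd m n) _.
  by rewrite [ltRHS]splitr ltrD //; exact: hN.
apply/cvg_ex; exists (sep_class cauchy_seminorm (CauchySequence cv)).
apply/cvgrPdist_lt => /= e e0.
have e30 : 0 < toR e / 3 by rewrite divr_gt0 // toR_gt0.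
have [N hN] := natSinv_lt e30.
apply: filterS (hv N) => z /= h.
rewrite -(subrK (completion_in (v N)) (sep_class _ _)) -addrA.
apply: le_lt_trans (ler_normD _ _) _.
rewrite -(toRK (ltW e0)).
have -> : toR e = toR e / 3 + toR e / 3 + toR e / 3 by field.
rewrite toCD ler_ltD //; last first.
  by apply: lt_trans h _; rewrite toC_lt; exact: hN (leqnn N).
rewrite distrC; apply: (@dist_completion (CauchySequence cv)) => n Nn /=.
by apply/ltW/(lt_trans (vd _ _)); rewrite ltrD //; apply: hN.
Qed.

HB.instance Definition _ :=
  Uniform_isComplete.Build completion completion_cauchy_cvg.

Lemma completion_extend (F : banach K) (f : {linear V -> F}) (C : K^re) :
  (forall x, `|f x| <= toC (C * p x)) ->
  exists g : completion -> F,
    [/\ linear g, continuous g & forall x, g (completion_in x) = f x].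
Proof.
move=> fC.
have C1 : 0 < `|C| + 1 by rewrite ltr_wpDl.
have fB x : `|f x| <= toC ((`|C| + 1) * p x).
  apply: le_trans (fC _) _; rewrite toC_le ler_wpM2r ?seminorm_ge0 //.
  by rewrite ler_wpDr // ler_norm.
have fcvg (u : cauchy_sequence) : cvgn (f \o u).
  apply/cauchy_cvgP/cauchy_exP => e e0.
  have [|N hN] := @cauchy_sequenceP u (toR e / (`|C| + 1)).
    by rewrite divr_gt0 // toR_gt0.
  exists (f (u N)); exists N => //= n /= Nn; rewrite -ball_normE /=.
  rewrite -raddfB; apply: le_lt_trans (fB _) _.
  rewrite -(toRK (ltW e0)) toC_lt mulrC -ltr_pdivlMr //; exact: hN.
pose L (u : cauchy_sequence) := limn (f \o u).
have Llin : linear L.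
  move=> a u v; apply/cvg_lim => //.
  rewrite (_ : f \o _ = (fun n => a *: (f \o u) n + (f \o v) n)).
    exact: cvgD (cvgZr (fcvg u)) (fcvg v).
  apply/funext => n /=.
  by rewrite [X in f X](cauchy_sequenceD (a *: u) v n) cauchy_sequenceZ linearP.
pose L' : {linear cauchy_sequence -> F} :=
  HB.pack L (GRing.isLinear.Build K cauchy_sequence F _ L Llin).
have LC (u : cauchy_sequence) :
    `|L' u| <= toC ((`|C| + 1) * cauchy_seminorm u).
  rewrite -(toRK (normr_ge0 _)) toC_le; apply/ler_addgt0Pr => e e0.
  have e0' : 0 < toC (e / 2) :> K by rewrite -toC0 toC_lt divr_gt0.
  have ec : 0 < e / 2 / (`|C| + 1) by rewrite !divr_gt0.
  near \oo => n.
  have h1 : `|L u - f (u n)| < toC (e / 2).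
    by near: n; apply: (@cvgr_dist_lt _ _ _ \oo _ (f \o u) _ (fcvg u)).
  have h2 : `|cauchy_norm u - p (u n)| < e / 2 / (`|C| + 1).
    by near: n; apply: (@cvgr_dist_lt _ _ _ \oo _ _ _ (@cauchy_norm_cvg u)).
  rewrite -toC_le (toRK (normr_ge0 _)) -(subrK (f (u n)) (L' u)).
  apply: le_trans (ler_normD _ _) _.
  apply: le_trans (lerD (ltW h1) (fB _)) _.
  rewrite -toCD toC_le; move: h2; rewrite ltr_norml => /andP[+ _].
  rewrite -(ltr_pM2l C1) mulrN [_ * (_ / _)]mulrC divfK ?gt_eqF //.
  by rewrite /= mulrBr; lra.
have [g [glin gcont gE]] := separation_extend LC.
exists g; split=> // x; rewrite /completion_in gE.
by apply/cvg_lim => //; exact: (@cvg_cst _ (f x) nat \oo _).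
Unshelve. all: by end_near. Qed.

Lemma completion_ext (F : banach K) (f g : completion -> F) :
  continuous f -> continuous g ->
  (forall x, f (completion_in x) = g (completion_in x)) -> f = g.
Proof.
move=> fc gc fg; apply/funext => z; apply/eqP; rewrite -subr_eq0 -normr_le0.
rewrite -(toRK (normr_ge0 _)) -toC0 toC_le; apply/ler_addgt0Pr => e e0.
have e0' : 0 < toC (e / 2) :> K by rewrite -toC0 toC_lt divr_gt0.
have /nbhs_ballP[d /= d0 dfg] : nbhs z [set t |
    `|f z - f t| < toC (e / 2) /\ `|g z - g t| < toC (e / 2)].
  by apply: filterI;
    [exact: (@cvgr_dist_lt _ _ _ (nbhs z) _ f _ (fc z) _ e0')
    |exact: (@cvgr_dist_lt _ _ _ (nbhs z) _ g _ (gc z) _ e0')].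
have [x xz] := @completion_dense z (toR d / 2) (divr_gt0 (toR_gt0 d0) (ltr0Sn _ _)).
have [] := dfg (completion_in x).
  rewrite -ball_normE /= distrC; apply: le_lt_trans xz _.
  rewrite -[ltRHS](toRK (ltW d0)) toC_lt ltr_pdivrMr // ltr_pMr ?toR_gt0 //.
  by rewrite ltr1n.
rewrite fg => h1 h2; rewrite add0r -toC_le (toRK (normr_ge0 _)).
rewrite -(subrK (g (completion_in x)) (f z)) -addrA.
apply: le_trans (ler_normD _ _) _; rewrite [X in toC X]splitr toCD.
by apply: lerD; apply: ltW => //; rewrite distrC.
Qed.

End Completion.

Definition multilinear (K : scalars) n (E : 'I_n -> lmodType K)
    (G : lmodType K) (A : (forall i, E i) -> G) : Prop :=
  forall (i : 'I_n) (x : forall i, E i) (a : K) (y z : E i),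
    A (dfwith x i (a *: y + z)) = a *: A (dfwith x i y) + A (dfwith x i z).

Definition homogeneous_polynomial (K : scalars) n (E G : lmodType K)
    (P : E -> G) : Prop :=
  exists2 A : ('I_n -> E) -> G,
    @multilinear K n (fun=> E) G A & forall x, P x = A (fun=> x).

Arguments homogeneous_polynomial {K} n {E G}.

Section Multilinear.
Context (K : scalars) (n : nat) (E : 'I_n -> lmodType K) (G : lmodType K).
Implicit Types A B : (forall i, E i) -> G.

Lemma multilinear0 : @multilinear K n E G 0.
Proof.
move=> i x a y z; have h : (0 : G) = a *: 0 + 0 by rewrite scaler0 addr0.
exact: h.
Qed.

Lemma multilinearP c A B :
  multilinear A -> multilinear B -> multilinear (c *: A + B).
Proof.
move=> hA hB i x a y z.
have e t : (c *: A + B) t = c *: A t + B t by [].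
by rewrite !e hA hB !scalerDr !scalerA [c * a]mulrC addrACA.
Qed.

Lemma multilinear_scale A (c : 'I_n -> K) x : multilinear A ->
  A (fun i => c i *: x i) = (\prod_i c i) *: A x.
Proof.
move=> hA.
have hA1 i (t : forall i, E i) a y :
    A (dfwith t i (a *: y)) = a *: A (dfwith t i y).
  have h0 : A (dfwith t i 0) = 0.
    have := hA i t 1 0 0; rewrite !scale1r addr0 => /eqP.
    by rewrite -subr_eq0 opprD addNKr oppr_eq0 => /eqP.
  by have := hA i t a y 0; rewrite h0 !addr0.
pose xk k (i : 'I_n) := if (i < k)%N then c i *: x i else x i.
suff h k : (k <= n)%N ->
    A (xk k) = (\prod_(i < n | (i < k)%N) c i) *: A x.
  have := h n (leqnn n).
  rewrite (_ : xk n = fun i => c i *: x i); last first.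
    by apply: functional_extensionality_dep => i; rewrite /xk ltn_ord.
  by move=> ->; congr (_ *: _); apply: eq_bigl => i; rewrite ltn_ord.
elim: k => [|k IH] kn; first by rewrite big1 ?scale1r.
pose j := Ordinal kn.
rewrite (bigD1 j) //= -scalerA.
rewrite (eq_bigl (fun i : 'I_n => (i < k)%N)); last first.
  by move=> i; rewrite ltnS [RHS]ltn_neqAle andbC.
rewrite -IH 1?ltnW //.
have -> : xk k.+1 = dfwith (xk k) j (c j *: x j).
  apply: functional_extensionality_dep => i.
  case: dfwithP => [|i' ji]; first by rewrite /xk ltnSn.
  by rewrite /xk ltnS leq_eqVlt eq_sym (negbTE (ji : (k : nat) != i')).
rewrite hA1; congr (_ *: A _); apply: functional_extensionality_dep => i.
by case: dfwithP => // ; rewrite /xk ltnn.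
Qed.

End Multilinear.

Section HomogeneousPolynomial.
Context (K : scalars) (n : nat) (E G : lmodType K).
Implicit Types P Q : E -> G.

Lemma homogeneous_polynomial0 : homogeneous_polynomial n (0 : E -> G).
Proof. by exists 0 => //; exact: multilinear0. Qed.

Lemma homogeneous_polynomialP c P Q :
  homogeneous_polynomial n P -> homogeneous_polynomial n Q ->
  homogeneous_polynomial n (c *: P + Q).
Proof.
move=> [A hA PA] [B hB QB]; exists (c *: A + B); first exact: multilinearP.
by move=> x; rewrite /GRing.add /GRing.scale /= PA QB.
Qed.

Lemma homogeneous_polynomial_scale P a x : homogeneous_polynomial n P ->
  P (a *: x) = a ^+ n *: P x.
Proof.
move=> [A hA PA]; rewrite !PA (multilinear_scale (fun=> a) (fun=> x) hA).
by rewrite prodr_const card_ord.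
Qed.

End HomogeneousPolynomial.

(** A tensor is a formal sum of elementary tensors, indexed by X; two formal
  sums define the same tensor when no test map (all n-linear maps, in the
  cases of interest) tells them apart, which is what the universal property of
  the tensor product says. *)

Section AlgebraicTensor.
Context (K : scalars) (X : choiceType).
Context (test : forall G : lmodType K, set (X -> G)).

Definition formal_sum := seq (K * X).

Definition eval_sum (G : lmodType K) (f : X -> G) (s : formal_sum) : G :=
  \sum_(c <- s) c.1 *: f c.2.

Definition tensor_equiv : rel formal_sum := fun s t =>
  `[< forall (G : lmodType K) (f : X -> G), test f ->
        eval_sum f s = eval_sum f t >].

Lemma tensor_equiv_refl : reflexive tensor_equiv.
Proof. by move=> s; apply/asboolP. Qed.

Lemma tensor_equiv_sym : symmetric tensor_equiv.
Proof.
by move=> s t; apply/asboolP/asboolP => h G f hf; rewrite h.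
Qed.

Lemma tensor_equiv_trans : transitive tensor_equiv.
Proof.
move=> t s r /asboolP h1 /asboolP h2; apply/asboolP => G f hf.
by rewrite h1 // h2.
Qed.

Canonical tensor_equiv_rel :=
  EquivRel tensor_equiv tensor_equiv_refl tensor_equiv_sym tensor_equiv_trans.

Definition alg_tensor := {eq_quot tensor_equiv}.
HB.instance Definition _ := EqQuotient.on alg_tensor.
HB.instance Definition _ := Choice.on alg_tensor.

Definition tensor_class (s : formal_sum) : alg_tensor := \pi s.

Lemma tensor_classP s t : tensor_class s = tensor_class t <->
  forall (G : lmodType K) (f : X -> G), test f -> eval_sum f s = eval_sum f t.
Proof.
by rewrite /tensor_class; split=> [/eqmodP/asboolP|h] //; apply/eqmodP/asboolP.
Qed.

Lemma tensor_ind (P : alg_tensor -> Prop) :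
  (forall s, P (tensor_class s)) -> forall z, P z.
Proof. by move=> h z; rewrite -[z]reprK; exact: h. Qed.

Lemma eval_repr (G : lmodType K) (f : X -> G) s : test f ->
  eval_sum f (repr (tensor_class s)) = eval_sum f s.
Proof. by move: G f; apply/tensor_classP; rewrite /tensor_class reprK. Qed.

Definition scale_sum (a : K) (s : formal_sum) : formal_sum :=
  [seq (a * c.1, c.2) | c <- s].

Lemma eval_cat (G : lmodType K) (f : X -> G) s t :
  eval_sum f (s ++ t) = eval_sum f s + eval_sum f t.
Proof. exact: big_cat. Qed.

Lemma eval_scale (G : lmodType K) (f : X -> G) a s :
  eval_sum f (scale_sum a s) = a *: eval_sum f s.
Proof.
rewrite /eval_sum big_map scaler_sumr; apply: eq_bigr => c _.
by rewrite /= scalerA.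
Qed.

Lemma eval_nil (G : lmodType K) (f : X -> G) : eval_sum f [::] = 0.
Proof. exact: big_nil. Qed.

Definition tensor_zero := tensor_class [::].
Definition tensor_add (z t : alg_tensor) := tensor_class (repr z ++ repr t).
Definition tensor_scale (a : K) (z : alg_tensor) :=
  tensor_class (scale_sum a (repr z)).
Definition tensor_opp := tensor_scale (-1).

Lemma tensor_addE s t :
  tensor_add (tensor_class s) (tensor_class t) = tensor_class (s ++ t).
Proof.
by apply/tensor_classP => G f hf; rewrite !eval_cat !eval_repr.
Qed.

Lemma tensor_scaleE a s :
  tensor_scale a (tensor_class s) = tensor_class (scale_sum a s).
Proof.
by apply/tensor_classP => G f hf; rewrite !eval_scale !eval_repr.
Qed.

Lemma tensor_addA : associative tensor_add.
Proof. by do 3!elim/tensor_ind => ?; rewrite !tensor_addE catA. Qed.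

Lemma tensor_addC : commutative tensor_add.
Proof.
do 2!elim/tensor_ind => ?; rewrite !tensor_addE.
by apply/tensor_classP => G f hf; rewrite !eval_cat addrC.
Qed.

Lemma tensor_add0 : left_id tensor_zero tensor_add.
Proof. by elim/tensor_ind => ?; rewrite tensor_addE. Qed.

Lemma tensor_addN : left_inverse tensor_zero tensor_opp tensor_add.
Proof.
elim/tensor_ind => s; rewrite /tensor_opp tensor_scaleE tensor_addE.
apply/tensor_classP => G f hf.
by rewrite eval_cat eval_scale scaleN1r addNr eval_nil.
Qed.

HB.instance Definition _ := GRing.isZmodule.Build alg_tensor
  tensor_addA tensor_addC tensor_add0 tensor_addN.

Lemma tensor_scaleA a b z :
  tensor_scale a (tensor_scale b z) = tensor_scale (a * b) z.
Proof.
elim/tensor_ind: z => s; rewrite !tensor_scaleE.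
by apply/tensor_classP => G f hf; rewrite !eval_scale scalerA.
Qed.

Lemma tensor_scale1 : left_id 1 tensor_scale.
Proof.
elim/tensor_ind => s; rewrite tensor_scaleE.
by apply/tensor_classP => G f hf; rewrite eval_scale scale1r.
Qed.

Lemma tensor_scaleDr : right_distributive tensor_scale +%R.
Proof.
move=> a; do 2!elim/tensor_ind => ?.
rewrite /GRing.add /= !(tensor_scaleE, tensor_addE).
by apply/tensor_classP => G f hf; rewrite !(eval_scale, eval_cat) scalerDr.
Qed.

Lemma tensor_scaleDl z : {morph tensor_scale^~ z : a b / a + b}.
Proof.
elim/tensor_ind: z => s a b.
rewrite [in RHS]/GRing.add /= !(tensor_scaleE, tensor_addE).
by apply/tensor_classP => G f hf; rewrite !(eval_scale, eval_cat) scalerDl.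
Qed.

HB.instance Definition _ := GRing.Zmodule_isLmodule.Build K alg_tensor
  tensor_scaleA tensor_scale1 tensor_scaleDr tensor_scaleDl.

Lemma tensor_classD s t :
  tensor_class (s ++ t) = tensor_class s + tensor_class t.
Proof. by rewrite -tensor_addE. Qed.

Lemma tensor_classZ a s :
  tensor_class (scale_sum a s) = a *: tensor_class s.
Proof. by rewrite -tensor_scaleE. Qed.

Definition elementary (x : X) : alg_tensor := tensor_class [:: (1, x)].

Definition lift_test (G : lmodType K) (f : X -> G) (z : alg_tensor) : G :=
  eval_sum f (repr z).

Lemma lift_testE (G : lmodType K) (f : X -> G) s : test f ->
  lift_test f (tensor_class s) = eval_sum f s.
Proof. exact: eval_repr. Qed.

Lemma lift_test_linear (G : lmodType K) (f : X -> G) :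
  test f -> linear (lift_test f).
Proof.
move=> hf a; do 2!elim/tensor_ind => ?.
by rewrite -tensor_classZ -tensor_classD !lift_testE // eval_cat eval_scale.
Qed.

Lemma alg_tensor_ext (G : lmodType K) (f g : alg_tensor -> G) :
  linear f -> linear g -> (forall x, f (elementary x) = g (elementary x)) ->
  f = g.
Proof.
move=> flin glin fg.
pose f' : {linear alg_tensor -> G} :=
  HB.pack f (GRing.isLinear.Build K alg_tensor G _ f flin).
pose g' : {linear alg_tensor -> G} :=
  HB.pack g (GRing.isLinear.Build K alg_tensor G _ g glin).
apply/funext; elim/tensor_ind; elim=> [|[a x] s IH].
  by rewrite -[f]/(f' : _ -> _) -[g]/(g' : _ -> _) [tensor_class _]/(0 : alg_tensor) !linear0.
have -> : tensor_class ((a, x) :: s) = a *: elementary x + tensor_class s.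
  by rewrite -tensor_classZ -tensor_classD /= mulr1.
by rewrite flin glin IH fg.
Qed.

(* The norm of the elementary tensor indexed by x will be w x. *)
Context (w : X -> K^re) (w_ge0 : forall x, 0 <= w x).

Definition cost (s : formal_sum) : K^re := \sum_(c <- s) toR `|c.1| * w c.2.

Definition proj_norm (z : alg_tensor) : K^re :=
  inf [set cost s | s in [set s | tensor_class s = z]].

Lemma cost_ge0 s : 0 <= cost s.
Proof. by apply: sumr_ge0 => c _; rewrite mulr_ge0 // toR_ge0. Qed.

Lemma proj_norm_le s : proj_norm (tensor_class s) <= cost s.
Proof.
by apply: ge_inf; [exists 0 => _ [t _ <-]; exact: cost_ge0|exists s].
Qed.

Lemma le_proj_norm z r :
  (forall s, tensor_class s = z -> r <= cost s) -> r <= proj_norm z.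
Proof.
move=> h; apply: lb_le_inf; last by move=> _ [s /= sz <-]; exact: h.
by exists (cost (repr z)); exists (repr z) => //=; exact: reprK.
Qed.

Lemma proj_norm_triangle z t : proj_norm (z + t) <= proj_norm z + proj_norm t.
Proof.
rewrite -lerBlDr; apply: le_proj_norm => s sz.
rewrite lerBlDl -lerBlDr; apply: le_proj_norm => r rt.
rewrite lerBlDr -sz -rt -tensor_classD; apply: le_trans (proj_norm_le _) _.
by rewrite /cost big_cat addrC.
Qed.

Lemma costZ a s : cost (scale_sum a s) = toR `|a| * cost s.
Proof.
rewrite /cost big_map mulr_sumr; apply: eq_bigr => c _ /=.
by rewrite normrM toRM // mulrA.
Qed.

Lemma proj_normZ_le a z : a != 0 -> proj_norm (a *: z) <= toR `|a| * proj_norm z.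
Proof.
move=> a0; have ra0 : 0 < toR `|a| by rewrite toR_gt0 // normr_gt0.
rewrite -ler_pdivrMl //; apply: le_proj_norm => s <-.
rewrite ler_pdivrMl // -costZ -tensor_classZ; exact: proj_norm_le.
Qed.

Lemma proj_normZ a z : proj_norm (a *: z) = toR `|a| * proj_norm z.
Proof.
have [->|a0] := eqVneq a 0.
  rewrite scale0r normr0 toR0 mul0r; apply/eqP; rewrite eq_le.
  rewrite (le_trans (proj_norm_le [::])) /=; last by rewrite /cost big_nil.
  by apply: le_proj_norm => s _; exact: cost_ge0.
apply/eqP; rewrite eq_le proj_normZ_le //=.
rewrite -{1}[z](scalerK a0) -ler_pdivlMl ?toR_gt0 ?normr_gt0 //.
apply: le_trans (proj_normZ_le _ _) _; first by rewrite invr_eq0.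
rewrite normfV ler_wpM2r //; first by apply: le_proj_norm => s _; exact: cost_ge0.
have na0 : 0 < `|a| by rewrite normr_gt0.
rewrite -toC_le toRK ?invr_ge0 // -(@ler_pM2l _ `|a|) // divff ?gt_eqF //.
by rewrite -{1}(toRK (normr_ge0 a)) -toCM divff ?toC1 // gt_eqF // toR_gt0.
Qed.

Definition proj_seminorm : seminorm alg_tensor :=
  Seminorm proj_norm_triangle proj_normZ.

(* The projective seminorm is in fact a norm, so that this Hausdorff completion
   is the usual completion. *)
Definition proj_tensor := completion proj_seminorm.
HB.instance Definition _ := CompleteNormedModule.on proj_tensor.

Definition proj_elementary (x : X) : proj_tensor :=
  completion_in proj_seminorm (elementary x).

Lemma proj_tensor_lift (F : banach K) (f : X -> F) (C : K^re) : test f ->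
  (forall x, `|f x| <= toC (C * w x)) ->
  exists g : proj_tensor -> F,
    [/\ linear g, continuous g & forall x, g (proj_elementary x) = f x].
Proof.
move=> hf fC.
pose L : {linear alg_tensor -> F} := HB.pack (lift_test f)
  (GRing.isLinear.Build K alg_tensor F _ (lift_test f) (lift_test_linear hf)).
have LC z : `|L z| <= toC (`|C| * proj_seminorm z).
  rewrite -(toRK (normr_ge0 _)) toC_le.
  have [C0|C0] := eqVneq C 0.
    elim/tensor_ind: z => s; rewrite C0 normr0 mul0r /L /= lift_testE //.
    rewrite [eval_sum _ _]big1 ?normr0 ?toR0 // => c _.
    have := fC c.2; rewrite C0 mul0r toC0 normr_le0 => /eqP ->.
    by rewrite scaler0.
  rewrite -ler_pdivrMl ?normr_gt0 //; apply: le_proj_norm => s <-.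
  rewrite ler_pdivrMl ?normr_gt0 // /L /= lift_testE // -toC_le toRK //.
  apply: le_trans (ler_norm_sum _ _ _) _.
  rewrite /cost mulr_sumr.
  elim: s => [|c s IH]; first by rewrite !big_nil toC0.
  rewrite !big_cons toCD lerD // normrZ -{1}(toRK (normr_ge0 c.1)).
  rewrite mulrCA toCM; apply: ler_wpM2l; first by rewrite toRK.
  apply: le_trans (fC _) _; rewrite toC_le ler_wpM2r //; exact: ler_norm.
have [g [glin gcont gE]] := completion_extend LC.
exists g; split=> // x; rewrite /proj_elementary gE /L /= lift_testE //.
by rewrite /eval_sum big_seq1 scale1r.
Qed.

Lemma proj_tensor_ext (F : banach K) (f g : proj_tensor -> F) :
  linear f -> continuous f -> linear g -> continuous g ->
  (forall x, f (proj_elementary x) = g (proj_elementary x)) -> f = g.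
Proof.
move=> flin fcont glin gcont fg; apply: completion_ext => // z.
have cD a x y : completion_in proj_seminorm (a *: x + y) =
    a *: completion_in proj_seminorm x + completion_in proj_seminorm y.
  by rewrite completion_inD completion_inZ.
suff /(congr1 (@^~ z)) : (fun t => f (completion_in proj_seminorm t)) =
  (fun t => g (completion_in proj_seminorm t)) by [].
apply: (@alg_tensor_ext F).
- by move=> a x y; rewrite /= cD flin.
- by move=> a x y; rewrite /= cD glin.
- exact: fg.
Qed.

End AlgebraicTensor.

Section NormScale.
Context (K : scalars).

Lemma norm_scaleK (E : normedModType K) (x : E) (r : K) : 0 < r ->
  (2 / r * `|x|) *: ((2 / r * `|x|)^-1 *: x) = x.
Proof.
move=> r0; have [->|x0] := eqVneq x 0; first by rewrite !scaler0.
by rewrite scalerA divff ?scale1r // !mulf_neq0 ?invr_eq0 ?normr_eq0 ?gt_eqF.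
Qed.

Lemma norm_scale_lt (E : normedModType K) (x : E) (r : K) : 0 < r ->
  `|(2 / r * `|x|)^-1 *: x| < r.
Proof.
move=> r0; have [->|x0] := eqVneq x 0; first by rewrite scaler0 normr0.
have x0' : 0 < `|x| by rewrite normr_gt0.
rewrite normrZ normfV gtr0_norm; last by rewrite !mulr_gt0 ?invr_gt0.
rewrite invfM invf_div -mulrA mulVf ?gt_eqF // mulr1.
by rewrite ltr_pdivrMr // ltr_pMr // ltr1n.
Qed.

Lemma toC_prod_norm n (E : 'I_n -> normedModType K) (x : forall i, E i) :
  toC (\prod_i toR `|x i|) = \prod_i `|x i|.
Proof.
rewrite (big_morph _ (@toCM K) toC1).
by apply: eq_bigr => i _; rewrite toRK.
Qed.

Lemma toCX (r : K^re) n : toC (r ^+ n) = toC r ^+ n.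
Proof. by elim: n => [|n IH]; rewrite ?toC1 // !exprS toCM IH. Qed.

End NormScale.

Section BoundedOperator.
Context (K : scalars) (E F : banach K).

Definition bounded_op_pred : {pred E -> F} :=
  mem [set u : E -> F | linear u /\ continuous u].

Lemma bounded_op_closed : submod_closed bounded_op_pred.
Proof.
split=> [|a u v]; rewrite !inE.
  split=> [a x y|x]; last exact: cvg_cst.
  have h : (0 : F) = a *: 0 + 0 by rewrite scaler0 addr0.
  exact: h.
move=> [ul uc] [vl vc]; split=> [b x y|x].
  have e t : (a *: u + v) t = a *: u t + v t by [].
  by rewrite !e ul vl !scalerDr !scalerA [a * b]mulrC addrACA.
exact: cvgD (cvgZr (uc x)) (vc x).
Qed.

HB.instance Definition _ :=
  GRing.isSubmodClosed.Build K (E -> F) bounded_op_pred bounded_op_closed.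

Record bounded_op := BoundedOp {
  bounded_op_fun :> E -> F; _ : bounded_op_fun \in bounded_op_pred }.

HB.instance Definition _ := [isSub for bounded_op_fun].
HB.instance Definition _ := [Choice of bounded_op by <:].
HB.instance Definition _ := [SubChoice_isSubLmodule of bounded_op by <:].

Lemma bounded_opP (u : bounded_op) : linear u /\ continuous u.
Proof. by have := valP u; rewrite inE. Qed.

End BoundedOperator.

Section BoundedMultilinear.
Context (K : scalars) (n : nat) (E : 'I_n -> banach K) (F : banach K).

Definition bounded_mlin_pred : {pred (forall i, E i) -> F} :=
  mem [set A : (forall i, E i) -> F | @multilinear K n E F A /\
    continuous (A : prod_topology E -> F)].

Lemma bounded_mlin_closed : submod_closed bounded_mlin_pred.
Proof.
split=> [|a u v]; rewrite !inE.
  by split=> [|x]; [exact: (@multilinear0 K n E F)|exact: (@cvg_cst F 0 (prod_topology E) (nbhs x) _)].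
move=> [ul uc] [vl vc]; split=> [|x]; first exact: multilinearP.
exact: cvgD (cvgZr (uc x)) (vc x).
Qed.

HB.instance Definition _ := GRing.isSubmodClosed.Build K
  ((forall i, E i) -> F) bounded_mlin_pred bounded_mlin_closed.

Record bounded_mlin := BoundedMlin {
  bounded_mlin_fun :> (forall i, E i) -> F;
  _ : bounded_mlin_fun \in bounded_mlin_pred }.

HB.instance Definition _ := [isSub for bounded_mlin_fun].
HB.instance Definition _ := [Choice of bounded_mlin by <:].
HB.instance Definition _ := [SubChoice_isSubLmodule of bounded_mlin by <:].

Lemma bounded_mlinP (A : bounded_mlin) :
  @multilinear K n E F A /\ continuous (A : prod_topology E -> F).
Proof. by have := valP A; rewrite inE. Qed.

Lemma bounded_mlin_bound (A : bounded_mlin) : exists C : K^re,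
  forall x, `|A x| <= toC (C * \prod_i toR `|x i|).
Proof.
have [Alin Acont] := bounded_mlinP A.
pose G : set_system (prod_topology E) := [set B | exists2 r : K, 0 < r &
  forall x : forall i, E i, (forall i, `|x i| < r) -> B x].
have FG : Filter G.
  split; first by exists 1.
    move=> B B' [r r0 rB] [r' r0' rB'].
    exists (toC (Num.min (toR r) (toR r'))).
      by rewrite -toC0 toC_lt lt_min !toR_gt0.
    move=> x h; split; [apply: rB|apply: rB'] => i; apply: lt_le_trans (h i) _.
      by rewrite -[leRHS](toRK (ltW r0)) toC_le ge_min lexx.
    by rewrite -[leRHS](toRK (ltW r0')) toC_le ge_min lexx orbT.
  by move=> B B' BB' [r r0 rB]; exists r => // x /rB; exact: BB'.
pose z0 : prod_topology E := fun=> 0.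
have G0 : G --> z0.
  apply/cvg_sup => i B [B' [[V oV <-] V0 VB]].
  have /nbhs_ballP[r r0 rV] : nbhs (0 : E i) V by exact: open_nbhs_nbhs.
  exists r => // x xr; apply/VB/rV; rewrite -ball_normE /= sub0r normrN.
  exact: xr.
have /G0[r r0 rA] : nbhs z0
    [set x | `|A z0 - A x| < 1].
  exact: (@cvgr_dist_lt _ _ _ (nbhs z0) _ A _ (Acont z0)).
pose M : K := `|A z0| + 1.
have M0 : 0 <= M by rewrite addr_ge0.
exists (toR ((2 / r) ^+ n * M)) => x.
pose c i : K := 2 / r * `|x i|.
have c0 i : 0 <= c i by rewrite mulr_ge0 // divr_ge0 // ltW.
have -> : A x = (\prod_i c i) *: A (fun i => (c i)^-1 *: x i).
  rewrite -(multilinear_scale _ _ Alin); congr (A _).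
  apply: functional_extensionality_dep => i; exact/esym/norm_scaleK.
rewrite normrZ toCM toRK; last first.
  by rewrite mulr_ge0 // exprn_ge0 // divr_ge0 // ltW.
rewrite toC_prod_norm ger0_norm; last by apply: prodr_ge0.
rewrite /c big_split /= prodr_const card_ord [leRHS]mulrAC.
apply: ler_wpM2l.
  by rewrite mulr_ge0 ?prodr_ge0 // exprn_ge0 // divr_ge0 // ltW.
have := rA (fun i => (c i)^-1 *: x i) (fun i => norm_scale_lt (x i) r0).
move=> /ltW h; rewrite -[X in `|X|](subKr (A z0)).
by apply: le_trans (ler_normB _ _) _; rewrite lerD2l.
Qed.

End BoundedMultilinear.

Section BoundedPolynomial.
Context (K : scalars) (n : nat) (E F : banach K).

Definition bounded_poly_pred : {pred E -> F} :=
  mem [set P : E -> F | homogeneous_polynomial n P /\ continuous P].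

Lemma bounded_poly_closed : submod_closed bounded_poly_pred.
Proof.
split=> [|a u v]; rewrite !inE.
  by split=> [|x]; [exact: homogeneous_polynomial0|exact: cvg_cst].
move=> [ul uc] [vl vc]; split=> [|x]; first exact: homogeneous_polynomialP.
exact: cvgD (cvgZr (uc x)) (vc x).
Qed.

HB.instance Definition _ :=
  GRing.isSubmodClosed.Build K (E -> F) bounded_poly_pred bounded_poly_closed.

Record bounded_poly := BoundedPoly {
  bounded_poly_fun :> E -> F; _ : bounded_poly_fun \in bounded_poly_pred }.

HB.instance Definition _ := [isSub for bounded_poly_fun].
HB.instance Definition _ := [Choice of bounded_poly by <:].
HB.instance Definition _ := [SubChoice_isSubLmodule of bounded_poly by <:].

Lemma bounded_polyP (P : bounded_poly) :
  homogeneous_polynomial n P /\ continuous P.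
Proof. by have := valP P; rewrite inE. Qed.

Lemma bounded_poly_bound (P : bounded_poly) : exists C : K^re,
  forall x, `|P x| <= toC (C * toR `|x| ^+ n).
Proof.
have [Pn Pcont] := bounded_polyP P.
have : nbhs (0 : E) [set x | `|P 0 - P x| < 1].
  exact: (@cvgr_dist_lt _ _ _ (nbhs (0 : E)) _ P _ (Pcont 0)).
move=> /nbhs_ballP[r r0 rP].
pose M : K := `|P 0| + 1.
have M0 : 0 <= M by rewrite addr_ge0.
exists (toR ((2 / r) ^+ n * M)) => x.
pose c : K := 2 / r * `|x|.
have c0 : 0 <= c by rewrite mulr_ge0 // divr_ge0 // ltW.
rewrite -{1}(norm_scaleK x r0) (homogeneous_polynomial_scale _ _ Pn).
rewrite normrZ toCM toRK; last first.
  by rewrite mulr_ge0 // exprn_ge0 // divr_ge0 // ltW.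
rewrite toCX toRK // normrX ger0_norm // exprMn [leRHS]mulrAC.
apply: ler_wpM2l.
  by rewrite mulr_ge0 ?exprn_ge0 // divr_ge0 // ltW.
have := rP (c^-1 *: x); rewrite -ball_normE /= sub0r normrN.
move=> /(_ (norm_scale_lt x r0))/ltW h; rewrite -[X in `|X|](subKr (P 0)).
by apply: le_trans (ler_normB _ _) _; rewrite lerD2l.
Qed.

End BoundedPolynomial.

Arguments bounded_poly {K} n E F.

Section TensorProducts.
Context (K : scalars).

Definition norm_prod n (E : 'I_n -> banach K) (x : forall i, E i) : K^re :=
  \prod_i toR `|x i|.

Lemma norm_prod_ge0 n (E : 'I_n -> banach K) (x : forall i, E i) :
  0 <= norm_prod x.
Proof. by apply: prodr_ge0 => i _; exact: toR_ge0. Qed.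

(* E_1 (x) ... (x) E_n, completed for the projective norm
   inf {sum_k |a_k| |x_k1| ... |x_kn| : z = sum_k a_k x_k1 (x) ... (x) x_kn} *)
Definition tensor_product n (E : 'I_n -> banach K) : banach K :=
  proj_tensor (fun G => @multilinear K n E G) (@norm_prod_ge0 n E).

Definition tensor n (E : 'I_n -> banach K) (x : forall i, E i) :
  tensor_product E := proj_elementary _ _ x.

Definition norm_pow n (E : banach K) (x : E) : K^re := toR `|x| ^+ n.

Lemma norm_pow_ge0 n (E : banach K) (x : E) : 0 <= norm_pow n x.
Proof. by rewrite exprn_ge0 // toR_ge0. Qed.

(* The subspace of E (x) ... (x) E spanned by the x (x) ... (x) x, completed for
   the symmetric projective norm
   inf {sum_k |a_k| |x_k|^n : z = sum_k a_k x_k (x) ... (x) x_k}.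
   The formal sums sum_k a_k x_k (x) ... (x) x_k and
   sum_l b_l y_l (x) ... (x) y_l are equal in E (x) ... (x) E iff
   sum_k a_k A (x_k, ..., x_k) = sum_l b_l A (y_l, ..., y_l)
   for all n-linear maps A. *)
Definition sym_tensor_product n (E : banach K) : banach K :=
  proj_tensor (fun G => @homogeneous_polynomial K n E G) (@norm_pow_ge0 n E).

Definition sym_tensor n (E : banach K) (x : E) : sym_tensor_product n E :=
  proj_elementary _ _ x.

Lemma mlin_linearization n (E : 'I_n -> banach K) (F : banach K)
    (A : bounded_mlin E F) :
  { u : bounded_op (tensor_product E) F | forall x, u (tensor x) = A x }.
Proof.
apply: cid; have [C AC] := bounded_mlin_bound A.
have [g [glin gcont gE]] := proj_tensor_lift (@norm_prod_ge0 n E)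
  ((bounded_mlinP A).1 : (fun G => @multilinear K n E G) F A) AC.
have gP : g \in @bounded_op_pred K (tensor_product E) F by rewrite inE.
by exists (BoundedOp gP).
Qed.

Lemma poly_linearization n (E F : banach K) (P : bounded_poly n E F) :
  { u : bounded_op (sym_tensor_product n E) F |
    forall x, u (sym_tensor n x) = P x }.
Proof.
apply: cid; have [C PC] := bounded_poly_bound P.
have [g [glin gcont gE]] := proj_tensor_lift (@norm_pow_ge0 n E)
  ((bounded_polyP P).1 :
    (fun G => @homogeneous_polynomial K n E G) F P) PC.
have gP : g \in @bounded_op_pred K (sym_tensor_product n E) F by rewrite inE.
by exists (BoundedOp gP).
Qed.

(* A_L and P_L; by the uniqueness lemmas below they are determined by their
   values on elementary tensors. *)
Definition linearize_mlin n (E : 'I_n -> banach K) (F : banach K)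
    (A : bounded_mlin E F) : bounded_op (tensor_product E) F :=
  sval (mlin_linearization A).

Definition linearize_poly n (E F : banach K) (P : bounded_poly n E F) :
    bounded_op (sym_tensor_product n E) F :=
  sval (poly_linearization P).

Lemma linearize_mlinE n (E : 'I_n -> banach K) (F : banach K)
    (A : bounded_mlin E F) x : linearize_mlin A (tensor x) = A x.
Proof. exact: (svalP (mlin_linearization A)). Qed.

Lemma linearize_polyE n (E F : banach K) (P : bounded_poly n E F) x :
  linearize_poly P (sym_tensor n x) = P x.
Proof. exact: (svalP (poly_linearization P)). Qed.

Lemma tensor_product_ext n (E : 'I_n -> banach K) (F : banach K)
    (u v : bounded_op (tensor_product E) F) :
  (forall x, u (tensor x) = v (tensor x)) -> u = v.
Proof.
have [ul uc] := bounded_opP u; have [vl vc] := bounded_opP v.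
by move=> uv; apply/val_inj; exact: proj_tensor_ext.
Qed.

Lemma sym_tensor_product_ext n (E F : banach K)
    (u v : bounded_op (sym_tensor_product n E) F) :
  (forall x, u (sym_tensor n x) = v (sym_tensor n x)) -> u = v.
Proof.
have [ul uc] := bounded_opP u; have [vl vc] := bounded_opP v.
by move=> uv; apply/val_inj; exact: proj_tensor_ext.
Qed.

End TensorProducts.

Record topology_on (T : choiceType) := TopologyOn {
  is_open : set (set T);
  is_openT : is_open setT;
  is_openI : setI_closed is_open;
  is_open_bigcup : forall I (A : I -> set T),
    (forall i, is_open (A i)) -> is_open (\bigcup_i A i)
}.

Definition topologized (T : choiceType) (t : topology_on T) : Type := T.

HB.instance Definition _ (T : choiceType) (t : topology_on T) :=
  Choice.copy (topologized t) T.
HB.instance Definition _ (T : choiceType) (t : topology_on T) :=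
  isOpenTopological.Build (topologized t)
    (@is_openT T t) (@is_openI T t) (@is_open_bigcup T t).

Record linear_topology (K : scalars) (V : lmodType K) := LinearTopology {
  linear_topology_sort :> topology_on V;
  linear_topology_add : continuous
    (fun z : topologized linear_topology_sort *
             topologized linear_topology_sort =>
       (z.1 : V) + (z.2 : V) : topologized linear_topology_sort);
  linear_topology_scale : continuous
    (fun z : K^o * topologized linear_topology_sort =>
       z.1 *: (z.2 : V) : topologized linear_topology_sort)
}.

Definition closure_in (T : choiceType) (t : topology_on T) (A : set T) : set T :=
  @closure (topologized t) A.

(* Continuous and open, which for a bijection means homeomorphism. It is only
   used for linearizations, whose bijectivity is a theorem rather than an
   assumption. *)
Definition homeo (S T : choiceType) (s : topology_on S) (t : topology_on T)
    (f : S -> T) : Prop :=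
  continuous (f : topologized s -> topologized t) /\
  forall A : set S, is_open s A -> is_open t (f @` A).

Section Ideals.
Context (K : scalars).

Definition operator_class :=
  forall E F : banach K, set (bounded_op E F).

Definition finite_rank (E F : banach K) (u : bounded_op E F) : Prop :=
  exists (k : nat) (y : 'I_k -> F),
    forall x, exists c : 'I_k -> K, u x = \sum_i c i *: y i.

Lemma bounded_op_comp_subproof (E F G : banach K) (v : bounded_op F G)
  (u : bounded_op E F) : v \o u \in @bounded_op_pred K E G.
Proof.
have [ul uc] := bounded_opP u; have [vl vc] := bounded_opP v.
rewrite inE; split=> [a x y|x]; first by rewrite /= ul vl.
by apply: continuous_comp; [exact: uc|exact: vc].
Qed.

Definition bounded_op_comp (E F G : banach K) (v : bounded_op F G)
    (u : bounded_op E F) : bounded_op E G :=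
  BoundedOp (bounded_op_comp_subproof v u).

Record operator_ideal (I : operator_class) : Prop := OperatorIdeal {
  ideal_lin : forall E F (a : K) (u v : bounded_op E F),
    I E F u -> I E F v -> I E F (a *: u + v);
  ideal_finite_rank : forall E F (u : bounded_op E F),
    finite_rank u -> I E F u;
  ideal_comp : forall E0 E F F0 (w : bounded_op F F0) (v : bounded_op E F)
      (u : bounded_op E0 E),
    I E F v -> I E0 F0 (bounded_op_comp w (bounded_op_comp v u))
}.

Definition ideal_poly (I : operator_class) n (E F : banach K) :
    set (bounded_poly n E F) :=
  [set P | exists (G : banach K) (Q : bounded_poly n E G)
      (u : bounded_op G F), I G F u /\ forall x, P x = u (Q x)].

(* The spaces L(E;F), P(^1E;F) and L(E_1;F) with n = 1 are here three different
   types, and no relation between their topologies is required beyond those of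
   [projective_ideal_topology]. *)
Record topologies := Topologies {
  op_top : forall E F : banach K, linear_topology (bounded_op E F);
  poly_top : forall n (E F : banach K), linear_topology (bounded_poly n E F);
  mlin_top : forall n (E : 'I_n -> banach K) (F : banach K),
    linear_topology (bounded_mlin E F)
}.

Definition closure_class
    (t : forall E F : banach K, linear_topology (bounded_op E F))
    (I : operator_class) : operator_class :=
  fun E F => closure_in (t E F) (I E F).

Definition ideal_topology
    (t : forall E F : banach K, linear_topology (bounded_op E F)) : Prop :=
  forall I, operator_ideal I -> operator_ideal (closure_class t I).

Record projective_ideal_topology (C : banach K -> Prop) (tau : topologies) :
    Prop := ProjectiveIdealTopology {
  projective_ideal : ideal_topology (op_top tau);
  projective_poly : forall n (E F : banach K), (0 < n)%N -> C E ->
    homeo (poly_top tau n E F) (op_top tau (sym_tensor_product n E) F)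
      (@linearize_poly K n E F);
  projective_mlin : forall n (E : 'I_n -> banach K) (F : banach K),
    (0 < n)%N -> (exists j, C (E j)) ->
    homeo (mlin_top tau E F) (op_top tau (tensor_product E) F)
      (@linearize_mlin K n E F)
}.

Definition WAP (I J : operator_class) (tau : topologies) (X : banach K) : Prop :=
  I X X `<=` closure_in (op_top tau X X) (J X X).

End Ideals.

(* Main.v *)
(* The map x |-> x (x) ... (x) x is itself a continuous n-homogeneous polynomial,
   so P |-> P_L maps I o P(^nE; F) onto I(T; F), where T is the symmetric tensor
   product. As this map is a homeomorphism, (a) and (b) say the same thing.
   For (a) => (c), E is complemented in T: if phi(a) = 1, the linearization pi
   of phi^(n-1) id maps the symmetrization of x (x) a (x) ... (x) a to a combination
   of x and phi(x) a in which x has a nonzero coefficient, from which x can be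
   recovered linearly. So id_E = rho o iota with iota : E -> T and rho : T -> E,
   and (a) applied to v o rho gives v = (v o rho) o iota. *)

Require Import Defs.
From HB Require Import structures.
From mathcomp Require Import all_boot all_order all_algebra.
From mathcomp Require Import all_classical all_reals.
From mathcomp Require Import topology normedtype.
From mathcomp Require Import complex ring.

Set Implicit Arguments.
Unset Strict Implicit.
Unset Printing Implicit Defensive.

Import Order.TTheory GRing.Theory Num.Theory.
Import numFieldNormedType.Exports.

Local Open Scope classical_set_scope.
Local Open Scope ring_scope.

(** * Polarization *)

Section Polarization.
Context (K : scalars) (n : nat).
Implicit Types (E G : lmodType K).

(** The sums are expanded one coordinate after the other. [j0] is the default value of a choice
    function on the coordinates that are not yet expanded. *)
Lemma multilinear_sum E G (A : ('I_n -> E) -> G) (J : finType) (j0 : J)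
    (F : 'I_n -> J -> E) :
  @multilinear K n (fun=> E) G A ->
  A (fun i => \sum_j F i j) =
  \sum_(f : {ffun 'I_n -> J}) A (fun i => F i (f i)).
Proof.
move=> hA.
have hA0 i (z : 'I_n -> E) : A (dfwith z i 0) = 0.
  have := hA i z 1 0 0; rewrite !scale1r addr0 => /eqP.
  by rewrite -subr_eq0 opprD addNKr oppr_eq0 => /eqP.
have hAs i (z : 'I_n -> E) (h : J -> E) :
    A (dfwith z i (\sum_j h j)) = \sum_j A (dfwith z i (h j)).
  apply: (big_ind2 (fun y t => A (dfwith z i y) = t)) => // y1 t1 y2 t2 <- <-.
  by rewrite -[y1]scale1r hA !scale1r.
(* The coordinates in [r] are the expanded ones. Functions in [pffun_on j0 (mem r) predT] equal [j0]
   off [r], so each choice on [r] is counted once. *)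
pose mix (r : seq 'I_n) (y z : 'I_n -> E) i := if i \in r then y i else z i.
suff mixE (r : seq 'I_n) z : uniq r ->
    A (mix r (fun i => \sum_j F i j) z) =
    \sum_(f in pffun_on j0 (mem r) predT) A (mix r (fun i => F i (f i)) z).
  have := mixE (index_enum 'I_n) 0 (index_enum_uniq _).
  have mT y z : mix (index_enum 'I_n) y z = y.
    by apply/funext => i; rewrite /mix mem_index_enum.
  rewrite mT => ->; apply: eq_big => [f|f _]; last by rewrite mT.
  by apply/familyP => i; rewrite /= mem_index_enum.
elim: r z => [|i r IHr] z /=.
  move=> _; rewrite (big_pred1 [ffun=> j0]) // => f.
  apply/familyP/eqP => /= [Df|-> i]; last by rewrite ffunE !inE.
  by apply/ffunP => i; rewrite ffunE; exact/eqP/Df.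
case/andP => nri Ur.
have mix_cons y z' : mix (i :: r) y z' = mix r y (dfwith z' i (y i)).
  apply/funext => k; rewrite /mix inE; case: eqVneq => [->|ki] /=.
    by rewrite (negbTE nri) dfwithin.
  by rewrite dfwithout // eq_sym.
have mix_with y t : mix r y (dfwith z i t) = dfwith (mix r y z) i t.
  apply/funext => k; have [<-|ik] := eqVneq i k.
    by rewrite /mix (negbTE nri) !dfwithin.
  by rewrite /mix !dfwithout.
rewrite mix_cons mix_with hAs.
rewrite (partition_big (fun f : {ffun 'I_n -> J} => f i) predT) //=.
(* Functions with value [j] at [i] correspond to functions supported on [r]: reset the value at [i]
   to [j0], or set it back to [j]. *)
pose seti j (f : {ffun 'I_n -> J}) := [ffun k => if k == i then j else f k].
apply: eq_bigr => j _; rewrite -mix_with IHr //.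
rewrite [RHS](reindex_onto (seti j) (seti j0)) => [|f /andP[_ /eqP fi]]; last first.
  by apply/ffunP=> k; rewrite !ffunE; case: eqP => // ->.
apply: eq_big => [f | f _].
  rewrite !ffunE !eqxx andbT; apply/familyP/andP=> /= [Pff|[Pjf fij0] k].
    have Pffi : f i = j0 by have := Pff i; rewrite (negbTE nri) inE => /eqP.
    split; [apply/familyP => k|apply/eqP/ffunP => k]; rewrite !ffunE /= ?inE.
      by case: eqVneq => //= _; exact: Pff.
    by case: eqVneq => [->|].
  have [->|ki] := eqVneq k i.
    by rewrite (negbTE nri) -(eqP fij0) !ffunE eqxx inE.
  by have := familyP Pjf k; rewrite /= !ffunE inE (negbTE ki).
rewrite mix_cons ffunE eqxx; congr A; apply/funext => k; rewrite /mix.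
by case: ifPn => // kr; rewrite ffunE ifN //; apply: contraNneq nri => <-.
Qed.

(** The polarization formula with coefficients 0 and 1; on a homogeneous polynomial it gives n!
    times the associated symmetric multilinear map. It makes sense for an arbitrary [f]. *)
Definition polarize E G (f : E -> G) (x : 'I_n -> E) : G :=
  \sum_(b : {ffun 'I_n -> bool})
    (\prod_i (if b i then 1 else -1) : K) *: f (\sum_i (b i)%:R *: x i).

(** After full expansion, the coefficient of [A (x \o s)] is an alternating sum over subsets which
    factors over the indices [i]. It is 1 when [s] hits every index and 0 otherwise, so only
    permutations survive. *)
Lemma polarize_diagonal E G (A : ('I_n -> E) -> G) x : (0 < n)%N ->
  @multilinear K n (fun=> E) G A ->
  polarize (fun y => A (fun=> y)) x =
  \sum_(s : {ffun 'I_n -> 'I_n} | injectiveb s) A (x \o s).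
Proof.
move=> n_gt0 hA; pose j0 := Ordinal n_gt0.
transitivity (\sum_(s : {ffun 'I_n -> 'I_n}) (\sum_(b : {ffun 'I_n -> bool})
  (\prod_i (if b i then 1 else -1)) * \prod_i ((b (s i))%:R : K)) *: A (x \o s)).
  under [RHS]eq_bigr => s _ do rewrite scaler_suml.
  rewrite exchange_big; apply: eq_bigr => b _ /=.
  rewrite (multilinear_sum j0 _ hA) scaler_sumr; apply: eq_bigr => s _.
  by rewrite -scalerA; congr (_ *: _); rewrite -multilinear_scale.
rewrite [RHS]big_mkcond; apply: eq_bigr => s _.
(* The factor at [i] adds the contributions of [b i = true] and [b i = false]; since [0 ^+ 0 = 1],
   they cancel exactly when [s] misses [i]. *)
pose m i := #|[pred j | s j == i]|.
rewrite (_ : \sum_(b : {ffun 'I_n -> bool}) _ =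
    \prod_i (1 - (0 ^+ m i : K))); last first.
  transitivity (\prod_i \sum_(c : bool) (if c then 1 else -1) * ((c%:R : K) ^+ m i)).
    rewrite bigA_distr_bigA; apply: eq_bigr => b _; rewrite big_split /=.
    congr (_ * _); rewrite (partition_big s predT) //=; apply: eq_bigr => i _.
    rewrite (eq_bigr (fun=> (b i)%:R)) => [|j /eqP ->//].
    by rewrite prodr_const.
  by apply: eq_bigr => i _; rewrite big_bool /= expr1n mul1r mulN1r.
case: ifPn => [/injectiveP s_inj|s_ninj].
  rewrite big1 ?scale1r // => i _; rewrite expr0n (_ : m i == 0%N = false) ?subr0 //.
  by apply/negbTE; rewrite -lt0n; apply/card_gt0P; exists (invF s_inj i);
    rewrite inE f_invF.
(* A self-map of a finite set that is not injective is not surjective either. *)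
have [i mi0] : exists i, m i = 0%N.
  apply: contrapT => mN0; move/injectiveP: s_ninj; apply.
  have /eqP/imset_injP inj : #|[set s j | j in 'I_n]%SET| = #|'I_n|.
    apply: eq_card => i; have : m i != 0%N by apply/eqP => mi; apply: mN0; exists i.
    by rewrite -lt0n => /card_gt0P[j /eqP <-]; exact: imset_f.
  by move=> i j; exact: inj.
by rewrite (bigD1 i) //= mi0 subrr mul0r scale0r.
Qed.

(** In the sum over permutations, the vector [x i] fills exactly one slot of each term, the one with
    index [invF s_inj i]. *)
Lemma polarize_multilinear E G (f : E -> G) : (0 < n)%N ->
  homogeneous_polynomial n f ->
  @multilinear K n (fun=> E) G (polarize f).
Proof.
move=> n_gt0 [A hA fA] i x a y z; have -> : f = fun t => A (fun=> t) by exact/funext.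
rewrite !polarize_diagonal // scaler_sumr -big_split.
apply: eq_bigr => s /injectiveP s_inj.
have comp_with t : dfwith x i t \o s = dfwith (x \o s) (invF s_inj i) t.
  apply/funext => j /=; have [->|ij] := eqVneq i (s j).
    by rewrite invF_f !dfwithin.
  by rewrite !dfwithout //; apply: contraNneq ij => <-; rewrite f_invF.
by rewrite !comp_with hA.
Qed.

Lemma polarize_cst E G (f : E -> G) x : (0 < n)%N ->
  homogeneous_polynomial n f -> polarize f (fun=> x) = n`!%:R *: f x.
Proof.
move=> n_gt0 [A hA fA]; have -> : f = fun t => A (fun=> t) by exact/funext.
rewrite polarize_diagonal //.
transitivity (\sum_(s in [set s : {ffun 'I_n -> 'I_n} | injectiveb s]%SET) A (fun=> x)).
  by apply: eq_bigl => s; rewrite inE.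
by rewrite sumr_const card_inj_ffuns card_ord ffactnn -scaler_nat.
Qed.

Lemma polarize_linear E G (H : lmodType K) (g : G -> H) (f : E -> G) x : linear g ->
  g (polarize f x) = polarize (g \o f) x.
Proof.
move=> glin; pose g' : {linear G -> H} := HB.pack g (GRing.isLinear.Build K G H _ g glin).
by rewrite -[g]/(g' : G -> H) linear_sum; apply: eq_bigr => b _; rewrite linearZ.
Qed.

End Polarization.

(** * Continuity of bounded homogeneous polynomials *)

Section BoundedHomogeneous.
Context (K : scalars) (n : nat) (n_gt0 : (0 < n)%N).

(** There are [2 ^+ n] subsets, and each partial sum has norm at most [M *+ n]. *)
Lemma norm_polarize_le (E F : normedModType K) (P : E -> F) (c M : K)
    (x : 'I_n -> E) :
  0 <= c -> (forall y, `|P y| <= c * `|y| ^+ n) -> (forall i, `|x i| <= M) ->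
  `|polarize P x| <= 2 ^+ n * (c * (M *+ n) ^+ n).
Proof.
move=> c0 Pc xM; apply: le_trans (ler_norm_sum _ _ _) _.
have -> : 2 ^+ n * (c * (M *+ n) ^+ n) =
    \sum_(b : {ffun 'I_n -> bool}) c * (M *+ n) ^+ n.
  by rewrite sumr_const card_ffun card_bool card_ord -[RHS]mulr_natl natrX.
apply: ler_sum => b _; rewrite normrZ normr_prod big1 => [|i _]; last first.
  by case: (b i); rewrite ?normrN1 ?normr1.
rewrite mul1r; apply: le_trans (Pc _) _; apply: ler_wpM2l => //.
rewrite lerXn2r ?nnegrE //.
  by rewrite mulrn_wge0 //; exact: le_trans (xM (Ordinal n_gt0)).
apply: le_trans (ler_norm_sum _ _ _) _.
rewrite -[X in _ *+ X](card_ord n) -sumr_const; apply: ler_sum => i _.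
by case: (b i); rewrite ?scale1r // scale0r normr0; exact: le_trans (xM i).
Qed.

(** [P] is Lipschitz at [x] on the unit ball around [x]: pass from [y] to [x] in the polarized map
    by changing one coordinate at a time. *)
Lemma homogeneous_polynomial_continuous (E F : normedModType K) (P : E -> F) (c : K) :
  0 <= c -> homogeneous_polynomial n P -> (forall y, `|P y| <= c * `|y| ^+ n) ->
  continuous P.
Proof.
move=> c0 Ph Pc x; pose A : ('I_n -> E) -> F := polarize P.
have Alin : @multilinear K n (fun=> E) F A by exact: polarize_multilinear.
have PA y : P y = n`!%:R^-1 *: A (fun=> y).
  by rewrite [A _]polarize_cst // scalerA mulVf ?scale1r // pnatr_eq0 -lt0n fact_gt0.
pose M : K := `|x| + 1; pose D := 2 ^+ n * (c * (M *+ n) ^+ n).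
have M0 : 0 <= M by rewrite addr_ge0.
have D0 : 0 <= D by rewrite !mulr_ge0 // exprn_ge0 // mulrn_wge0.
have PD y : `|x - y| <= 1 -> `|P x - P y| <= n`!%:R^-1 * (D *+ n) * `|x - y|.
  move=> xy1.
  have yM : `|y| <= M.
    by rewrite -(subKr x y); apply: le_trans (ler_normB _ _) _; rewrite lerD2l.
  have xM : `|x| <= M by rewrite lerDl.
  pose z k (i : 'I_n) : E := if (i < k)%N then x else y.
  have step k : (k < n)%N -> `|A (z k.+1) - A (z k)| <= D * `|x - y|.
    move=> kn; pose i := Ordinal kn; pose d := `|x - y|.
    have zi : z k = dfwith (z k) i y.
      apply/funext => j; have [<-|ij] := eqVneq i j; last by rewrite dfwithout.
      by rewrite dfwithin /z ltnn.
    (* Writing [x] as [y] plus [d] times a vector of norm at most 1 lets linearity in slot [i]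
       extract the factor [d]. If [d = 0], then [d^-1 = 0] and [x = y], so the formula still holds.
       The summand 1 in [M] covers the normalized vector. *)
    have zi1 : z k.+1 = dfwith (z k) i (d *: (d^-1 *: (x - y)) + y).
      have -> : d *: (d^-1 *: (x - y)) + y = x.
        have [/eqP|d0] := eqVneq d 0; last by rewrite scalerA divff ?scale1r ?subrK.
        rewrite normr_eq0 subr_eq0 => /eqP ->.
        by rewrite subrr !scaler0 add0r.
      apply/funext => j; have [<-|ij] := eqVneq i j; first by rewrite dfwithin /z ltnSn.
      rewrite dfwithout // /z ltnS leq_eqVlt eq_sym.
      by rewrite (negbTE (ij : (k : nat) != j)).
    rewrite zi1 [in X in _ - X]zi Alin addrK normrZ normr_id mulrC ler_wpM2r //.
    apply: norm_polarize_le => // j; have [<-|ij] := eqVneq i j.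
      rewrite dfwithin normrZ normfV normr_id -/d.
      have [->|d0] := eqVneq d 0; first by rewrite invr0 mul0r.
      by rewrite mulVf // lerDr.
    by rewrite dfwithout // /z; case: ifP.
  rewrite !PA -scalerBr normrZ ger0_norm ?invr_ge0 // -mulrA.
  apply: ler_wpM2l; first by rewrite invr_ge0.
  have -> : A (fun=> x) - A (fun=> y) = \sum_(0 <= k < n) (A (z k.+1) - A (z k)).
    rewrite (telescope_sumr (A \o z)) //=; congr (A _ - A _).
    by apply/funext => i; rewrite /z ltn_ord.
  apply: le_trans (ler_norm_sum _ _ _) _.
  rewrite mulrnAl -[X in _ *+ X](subn0 n) -sumr_const_nat; apply: ler_sum_nat => k.
  by move=> /andP[_ kn]; exact: step.
(* Adding 1 to the Lipschitz constant makes it positive, so that [e] can be divided by it. *)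
pose C := n`!%:R^-1 * (D *+ n) + 1.
have C0 : 0 < C by rewrite ltr_wpDl // mulr_ge0 ?invr_ge0 // mulrn_wge0.
apply/cvgrPdist_lt => e e0; near=> y.
have xy : `|x - y| < e / C.
  by near: y; apply: (@cvgr_dist_lt _ _ _ (nbhs x) _ id) => //; rewrite divr_gt0.
apply: le_lt_trans (PD y _) _.
  by apply: ltW; near: y; exact: (@cvgr_dist_lt _ _ _ (nbhs x) _ id).
apply: (@le_lt_trans _ _ (C * `|x - y|)); first by rewrite ler_wpM2r // lerDl.
by rewrite mulrC -ltr_pdivlMr.
Unshelve. all: by end_near. Qed.

End BoundedHomogeneous.

(** * The canonical polynomial into the symmetric tensor product *)

Section SymmetricTensor.
Context (K : scalars) (n : nat) (n_gt0 : (0 < n)%N) (E : banach K).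

(** Tensors are equal as soon as all lifts of homogeneous polynomials agree on them. These lifts are
    linear, hence commute with [polarize], which reduces the claim to polarization of scalar
    multiples and sums in each target [G]. *)
Lemma elementary_homogeneous : homogeneous_polynomial n
  (@elementary K E (fun G => @homogeneous_polynomial K n E G)).
Proof.
set el := elementary _.
have test_eq u v : (forall (G : lmodType K) (f : E -> G), homogeneous_polynomial n f ->
    lift_test f u = lift_test f v) ->
    u = v :> alg_tensor (fun G => @homogeneous_polynomial K n E G).
  elim/tensor_ind: u => s; elim/tensor_ind: v => t st.
  apply/tensor_classP => G f hf.
  pose test (G : lmodType K) := @homogeneous_polynomial K n E G.
  by rewrite -!(@lift_testE _ _ test) // st.
have lift_el (G : lmodType K) (f : E -> G) : homogeneous_polynomial n f ->
    lift_test f \o el = f.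
  move=> hf; apply/funext => u; rewrite /= lift_testE // /eval_sum big_seq1.
  exact: scale1r.
have lift_pol (G : lmodType K) (f : E -> G) (t : 'I_n -> E) :
    homogeneous_polynomial n f -> lift_test f (polarize el t) = polarize f t.
  by move=> hf; rewrite (polarize_linear _ _ (lift_test_linear hf)) lift_el.
exists (n`!%:R^-1 *: (polarize el : ('I_n -> E) -> _)).
  rewrite -[_ *: _]addr0; apply: multilinearP; last exact: multilinear0.
  move=> i x a y z; apply: test_eq => G f hf.
  rewrite (lift_test_linear hf) !lift_pol //; exact: polarize_multilinear.
move=> x; apply: test_eq => G f hf.
pose f' : {linear alg_tensor (fun G => @homogeneous_polynomial K n E G) -> G} :=
  HB.pack (lift_test f) (GRing.isLinear.Build K _ G _ _ (lift_test_linear hf)).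
rewrite -[lift_test f]/(f' : _ -> _) linearZ /= [X in _ *: X]lift_pol //.
rewrite polarize_cst // scalerA mulVf ?scale1r ?pnatr_eq0 -?lt0n ?fact_gt0 //.
exact: (congr1 (@^~ x) (lift_el _ _ hf)).
Qed.

Lemma sym_tensor_homogeneous : homogeneous_polynomial n (@sym_tensor K n E).
Proof.
have [A Alin AE] := elementary_homogeneous.
exists (fun x => completion_in _ (A x)); last first.
  by move=> x; rewrite /sym_tensor /proj_elementary AE.
by move=> i x a y z; rewrite Alin completion_inD completion_inZ.
Qed.

(** The one-term formal sum [[:: (1, x)]] already has this cost. *)
Lemma norm_sym_tensor_le (x : E) : `|sym_tensor n x| <= `|x| ^+ n.
Proof.
rewrite norm_completion_in -[leRHS]toRK ?exprn_ge0 // toC_le.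
apply: (@le_trans _ _ (cost (@norm_pow K n E) [:: (1, x)])).
  exact: (proj_norm_le _ (@norm_pow_ge0 K n E)).
rewrite /cost big_seq1 /= normr1 toR1 mul1r /norm_pow.
by rewrite -toC_le toCX !toRK // exprn_ge0.
Qed.

Lemma sym_tensor_subproof : @sym_tensor K n E \in
  @bounded_poly_pred K n E (sym_tensor_product n E).
Proof.
rewrite inE; split; first exact: sym_tensor_homogeneous.
apply: (homogeneous_polynomial_continuous n_gt0 (c := 1)) => //.
  exact: sym_tensor_homogeneous.
by move=> x; rewrite mul1r; exact: norm_sym_tensor_le.
Qed.

Definition sym_tensor_poly : bounded_poly n E (sym_tensor_product n E) :=
  BoundedPoly sym_tensor_subproof.
End SymmetricTensor.

(** * The Hahn-Banach theorem *)

Section SublinearFunctionals.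
Context (K : scalars) (V : lmodType K).
Implicit Types (p : V -> K^re).

(** Only real scalars enter, so a complex space is treated as a real one. The inequality for
    nonnegative [r] yields equality, by applying it to [r^-1] as well. *)
Definition sublinear p :=
  (forall x y, p (x + y) <= p x + p y) /\
  (forall r x, 0 <= r -> p (toC r *: x) <= r * p x).

Lemma sublinear0 p : sublinear p -> p 0 = 0.
Proof.
move=> [pD pZ]; apply/eqP; rewrite eq_le; apply/andP; split.
  by have := pZ 0 0 (lexx _); rewrite scaler0 mul0r.
by have := pD 0 0; rewrite addr0 lerDl.
Qed.

Lemma sublinear_opp_ge p x : sublinear p -> - p (- x) <= p x.
Proof.
by move=> ps; have := ps.1 x (- x); rewrite subrr sublinear0 // -lerBlDr sub0r.
Qed.

Lemma sublinear_scale_ge p r x : sublinear p -> 0 <= r -> r * p x <= p (toC r *: x).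
Proof.
move=> ps; rewrite le_eqVlt => /predU1P[<-|r0].
  by rewrite toC0 scale0r mul0r sublinear0.
rewrite -ler_pdivlMl //; apply: le_trans (ps.2 r^-1 _ _); last by rewrite invr_ge0 ltW.
by rewrite scalerA -toCM mulVf ?gt_eqF // toC1 scale1r.
Qed.

(** Common to two constructions: the infimum of shifts of one functional and the infimum of a chain.
    The minorant [l] keeps the infimum finite. *)
Lemma sublinear_inf (I : Type) (D : set I) (i0 : I) (g : I -> V -> K^re) (l : V -> K^re) :
  D i0 -> (forall i x, D i -> l x <= g i x) ->
  (forall i j x y, D i -> D j -> exists2 k, D k & g k (x + y) <= g i x + g j y) ->
  (forall i r x, D i -> 0 <= r -> exists2 k, D k & g k (toC r *: x) <= r * g i x) ->
  let q x := inf [set g i x | i in D] in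
  sublinear q /\ forall i x, D i -> q x <= g i x.
Proof.
move=> D0 lg gD gZ q.
have q_le i x : D i -> q x <= g i x.
  by move=> Di; apply: ge_inf; [exists (l x) => _ [j Dj <-]; exact: lg|exists i].
have le_q c x : (forall i, D i -> c <= g i x) -> c <= q x.
  move=> h; apply: lb_le_inf; last by move=> _ [i Di <-]; exact: h.
  by exists (g i0 x); exists i0.
split=> //; split=> [x y|r x].
  rewrite -lerBlDr; apply: (le_q) => i Di.
  rewrite lerBlDl -lerBlDr; apply: (le_q) => j Dj; rewrite lerBlDr.
  have [k Dk h] := gD j i y x Dj Di; rewrite [x + y]addrC.
  exact: le_trans (q_le _ _ Dk) h.
rewrite le_eqVlt => /predU1P[r0|r0]; last first.
  rewrite -ler_pdivrMl //; apply: (le_q) => i Di; rewrite ler_pdivrMl //.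
  have [k Dk h] := gZ i r x Di (ltW r0); exact: le_trans (q_le _ _ Dk) h.
have [k Dk h] := gZ i0 r x D0 (eq_ind _ (fun r => 0 <= r) (lexx 0) _ r0).
by apply: le_trans (q_le _ _ Dk) _; apply: le_trans h _; rewrite -r0 !mul0r.
Qed.

(** [q x] is the infimum of [p (x + toC t *: a) - t * p a] over nonnegative [t]. Taking [t = 0] puts
    it below [p], and subadditivity bounds it below by [- p (- x)]. *)
Lemma sublinear_shift p a : sublinear p ->
  exists q, [/\ sublinear q, forall x, q x <= p x &
    forall x t, 0 <= t -> q x <= p (x + toC t *: a) - t * p a].
Proof.
move=> ps; pose g t x := p (x + toC t *: a) - t * p a.
have [||||qs qg] := @sublinear_inf _ [set t | 0 <= t] 0 g (fun x => - p (- x)).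
- exact: lexx.
- move=> t x t0; rewrite lerBrDr.
  apply: le_trans (lerD (lexx _) (sublinear_scale_ge _ ps t0)) _.
  rewrite addrC lerBlDr; apply: le_trans (ps.1 _ _).
  by rewrite addrC addKr.
- move=> t s x y t0 s0; exists (t + s); first exact: addr_ge0.
  rewrite /g toCD scalerDl addrACA mulrDl opprD [leRHS]addrACA.
  by rewrite lerD2r; exact: ps.1.
- move=> t r x t0 r0; exists (r * t); first exact: mulr_ge0.
  by rewrite /g toCM -scalerA -scalerDr mulrBr mulrA lerD2r ps.2.
exists (fun x => inf [set g t x | t in [set t | 0 <= t]]); split=> // [x|x t t0].
  by apply: le_trans (qg 0 x (lexx _)) _; rewrite /g toC0 scale0r addr0 mul0r subr0.
exact: qg.
Qed.

(** Zorn's lemma for the reversed pointwise order; a nonempty chain is bounded by its pointwise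
    infimum, finite because every member is at least [- p0 (- x)]. *)
Lemma minimal_sublinear p0 : sublinear p0 ->
  exists p, [/\ sublinear p, forall x, p x <= p0 x &
    forall q, sublinear q -> (forall x, q x <= p x) -> q = p].
Proof.
move=> p0s; pose P p := sublinear p /\ forall x, p x <= p0 x.
pose T := {p : V -> K^re | P p}.
pose R (s t : T) := `[< forall x, sval t x <= sval s x >].
have Rrefl t : R t t by apply/asboolP.
have [|A Atot|p pmin] := ZL_preorder (exist P p0 (conj p0s (fun=> lexx _))) Rrefl.
- move=> r s t /asboolP rs /asboolP st; apply/asboolP => x.
  exact: le_trans (st x) (rs x).
- have [->|/set0P[s0 As0]] := eqVneq A set0.
    by exists (exist P p0 (conj p0s (fun=> lexx _))).
  have sval_ge (s : T) x : - p0 (- x) <= sval s x.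
    case: s => p [ps pp0] /=; apply: le_trans (sublinear_opp_ge x ps).
    by rewrite lerN2.
  have [||||qs qA] := @sublinear_inf _ A s0 sval (fun x => - p0 (- x)).
  + by [].
  + by move=> s x _; exact: sval_ge.
  + move=> s t x y As At; have [/asboolP st|/asboolP ts] := Atot s t As At.
      exists t => //; apply: le_trans ((svalP t).1.1 _ _) _.
      by rewrite lerD2r.
    exists s => //; apply: le_trans ((svalP s).1.1 _ _) _.
    by rewrite lerD2l.
  + by move=> s r x As r0; exists s => //; exact: (svalP s).1.2.
  have qp0 x : inf [set sval s x | s in A] <= p0 x.
    exact: le_trans (qA s0 x As0) ((svalP s0).2 x).
  by exists (exist P _ (conj qs qp0)) => s As; apply/asboolP => x; exact: qA.
exists (sval p); split=> [|x|q qs qp]; [exact: (svalP p).1|exact: (svalP p).2|].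
have qp0 x : q x <= p0 x := le_trans (qp x) ((svalP p).2 x).
have /asboolP pq : R (exist P q (conj qs qp0)) p by apply: pmin; apply/asboolP.
by apply/funext => x; apply/eqP; rewrite eq_le qp pq.
Qed.

(* A minimal sublinear functional is additive, since otherwise one of its
   shifts would lie strictly below it. *)
Lemma sublinear_hahn_banach p a : sublinear p ->
  exists f : V -> K^re, [/\ forall x y, f (x + y) = f x + f y,
    forall r x, f (toC r *: x) = r * f x, forall x, f x <= p x & f a = p a].
Proof.
(* Shifting along [a] before minimizing gives [f (- a) <= q (- a) <= - p a], which forces
   [f a = p a]. *)
move=> ps; have [q [qs qp qa]] := sublinear_shift a ps.
have [f [fs fq fmin]] := minimal_sublinear qs.
have fD x y : f (x + y) = f x + f y.
  have [g [gs gf gy]] := sublinear_shift y fs.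
  apply/eqP; rewrite eq_le fs.1 /= -lerBrDr.
  have := gy x 1 ler01; rewrite toC1 scale1r mul1r.
  by rewrite (fmin _ gs gf).
have fN x : f (- x) = - f x.
  by apply/eqP; rewrite -addr_eq0 -fD addNr sublinear0.
have fZ0 r x : 0 <= r -> f (toC r *: x) = r * f x.
  by move=> r0; apply/eqP; rewrite eq_le fs.2 // sublinear_scale_ge.
exists f; split=> // [r x|x|].
- have [r0|/ltW r0] := leP 0 r; first exact: fZ0.
  have toCN : toC (- r) = - toC r :> K.
    by apply/eqP; rewrite -addr_eq0 -toCD addNr toC0.
  apply: oppr_inj; rewrite -fN -scaleNr -toCN -mulNr fZ0 //.
  by rewrite oppr_ge0.
- exact: le_trans (fq x) (qp x).
apply/eqP; rewrite eq_le (le_trans (fq a)) //= -[leRHS]opprK lerNr -fN.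
apply: le_trans (fq _) _; apply: le_trans (qa (- a) 1 ler01) _.
by rewrite toC1 scale1r addNr sublinear0 // mul1r sub0r.
Qed.

End SublinearFunctionals.

Lemma toC_ge0 (K : scalars) (r : K^re) : 0 <= r -> 0 <= toC r :> K.
Proof. by rewrite -toC0 toC_le. Qed.

Lemma sublinear_norm (K : scalars) (E : normedModType K) :
  sublinear (fun x : E => toR `|x|).
Proof.
split=> [x y|r x r0]; first by rewrite -toRD toR_le // ler_normD.
by rewrite normrZ toRM // ger0_norm ?toC_ge0 // toCK.
Qed.

Lemma norm_toC (K : scalars) (r : K^re) : `|toC r : K| = toC `|r|.
Proof.
have [r0|r0] := leP 0 r.
  rewrite (ger0_norm r0) ger0_norm //; exact: toC_ge0.
have toCN : toC (- r) = - toC r :> K.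
  by apply/eqP; rewrite -addr_eq0 -toCD addNr toC0.
rewrite (ltr0_norm r0) toCN -normrN -toCN ger0_norm //.
by apply: toC_ge0; rewrite oppr_ge0 ltW.
Qed.

(** Hahn-Banach for the norm gives a real-linear [f] with [f a] equal to the norm of [a]; it remains
    to make it [K]-linear and to rescale it. *)
Lemma bounded_functional (K : scalars) (E : normedModType K) (a : E) : a != 0 ->
  exists phi : E -> K, exists c : K, [/\
    forall k x y, phi (k *: x + y) = k * phi x + phi y,
    forall x, `|phi x| <= c * `|x| & phi a = 1].
Proof.
move=> a0.
suff [phi [c [philin phic phia]]] : exists phi : E -> K, exists c : K, [/\
    forall k x y, phi (k *: x + y) = k * phi x + phi y,
    forall x, `|phi x| <= c * `|x| & phi a != 0].
  exists (fun x => (phi a)^-1 * phi x), (`|(phi a)^-1| * c); split.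
  - by move=> k x y; rewrite philin mulrDr mulrCA.
  - by move=> x; rewrite normrM -mulrA ler_wpM2l.
  - by rewrite mulVf.
have [f [fD fZ fle fa]] := sublinear_hahn_banach a (sublinear_norm E).
have fN x : f (- x) = - f x.
  by apply/eqP; rewrite -addr_eq0 -fD addNr -(scale0r 0) -toC0 fZ mul0r.
have f_norm x : `|toC (f x) : K| <= `|x|.
  rewrite norm_toC -[leRHS]toRK // toC_le ler_norml fle andbT lerNl -fN.
  by rewrite -normrN fle.
have fa0 : f a != 0 by rewrite fa gt_eqF // toR_gt0 // normr_gt0.
case: K E a a0 f fD fZ fle fa fN f_norm fa0 => R E a a0 f fD fZ _ _ fN f_norm fa0.
  exists f, 1; split=> // [k x y|x]; first by rewrite fD fZ.
  by rewrite mul1r; exact: f_norm.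
pose im : R[i] := Complex 0 1.
have fC (k : R[i]) x : f (k *: x) = complex.Re k * f x + complex.Im k * f (im *: x).
  rewrite -!fZ scalerA -fD -scalerDl; congr (f (_ *: x)).
  case: k => u v; apply/eqP; rewrite eq_complex /=.
  by apply/andP; split; apply/eqP; ring.
(* The usual complexification of [f], whose real part is [f] and so does not vanish at [a]. The
   triangle inequality gives the constant 2. *)
exists (fun x => Complex (f x) (- f (im *: x))), 2; split=> [k x y|x|].
- apply/eqP; rewrite eq_complex; apply/andP; split; apply/eqP.
    by rewrite /= fD fC; case: k => u v /=; ring.
  by rewrite /= scalerDr fD scalerA fC; case: k => u v /=; ring.
- have -> : Complex (f x) (- f (im *: x)) =
      @toC (ComplexScalars R) (f x) - im * @toC (ComplexScalars R) (f (im *: x)).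
    by apply/eqP; rewrite eq_complex /=; apply/andP; split; apply/eqP; ring.
  have im1 : `|im| = 1 by rewrite /im normc_def /= expr0n expr1n add0r sqrtr1.
  apply: le_trans (ler_normB _ _) _; rewrite mulrDl mul1r lerD //.
  rewrite normrM im1 mul1r; apply: le_trans (f_norm _) _.
  by rewrite normrZ im1 mul1r.
by apply: contraNneq fa0 => -[->].
Qed.

(** * Complementation of E in its symmetric tensor product *)

Section Complementation.
Context (K : scalars) (n : nat) (n_gt0 : (0 < n)%N) (E : banach K).

Let T := sym_tensor_product n E.

(** A linear map is a 1-homogeneous polynomial, so the continuity criterion for polynomials
    applies. *)
Lemma bounded_linear_op (F G : banach K) (u : F -> G) (c : K) : linear u -> 0 <= c ->
  (forall x, `|u x| <= c * `|x|) -> exists v : bounded_op F G, v =1 u.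
Proof.
move=> ulin c0 uc.
have hu : u \in @bounded_op_pred K F G.
  rewrite inE; split=> // x.
  apply: (@homogeneous_polynomial_continuous K 1 isT F G u c) => //.
  exists (fun x => u (x ord0)) => // i y a z t.
  by rewrite (ord1 i) !dfwithin ulin.
by exists (BoundedOp hu).
Qed.

Lemma sym_tensor_complemented : exists (iota : bounded_op E T) (rho : bounded_op T E),
  forall x, rho (iota x) = x.
Proof.
(* If [E] is zero, the zero operators do. *)
have [[a a0]|E0] := pselect (exists a : E, a != 0); last first.
  exists 0, 0 => x; apply/esym/eqP; apply: contrapT => x0; apply: E0.
  by exists x; apply/negP.
have [phi [c [philin phic phia]]] := bounded_functional a0.
have c0 : 0 <= c.
  rewrite -(@pmulr_lge0 _ `|a|) ?normr_gt0 //; exact: le_trans (normr_ge0 _) (phic a).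
pose i0 := Ordinal n_gt0.
pose B (z : 'I_n -> E) : E := (\prod_(j | j != i0) phi (z j)) *: z i0.
have Blin : @multilinear K n (fun=> E) E B.
  move=> i z k x y; rewrite /B; have [->|ii0] := eqVneq i i0.
    have prodE t : \prod_(j | j != i0) phi (dfwith z i0 t j) =
        \prod_(j | j != i0) phi (z j).
      by apply: eq_bigr => j ji0; rewrite dfwithout // eq_sym.
    by rewrite !prodE !dfwithin scalerDr !scalerA [k * _]mulrC.
  have prodE t : \prod_(j | j != i0) phi (dfwith z i t j) =
      phi t * \prod_(j | (j != i0) && (j != i)) phi (z j).
    rewrite (bigD1 i) //= dfwithin; congr (_ * _).
    by apply: eq_bigr => j /andP[_ ji]; rewrite dfwithout // eq_sym.
  by rewrite !prodE !dfwithout // philin mulrDl scalerDl -mulrA scalerA.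
pose P x := B (fun=> x).
have Phom : homogeneous_polynomial n P by exists B.
have hP : P \in @bounded_poly_pred K n E E.
  rewrite inE; split=> //.
  apply: (homogeneous_polynomial_continuous n_gt0 (c := \prod_(j < n | j != i0) c)) => //.
    by apply: prodr_ge0.
  move=> x; rewrite normrZ normr_prod.
  rewrite -[X in _ ^+ X](card_ord n) -prodr_const [X in _ <= _ * X](bigD1 i0) //=
    [`|x| * _]mulrC mulrA.
  apply: ler_wpM2r => //; rewrite -big_split /=; apply: ler_prod => j _.
  by rewrite normr_ge0 phic.
pose pi := linearize_poly (BoundedPoly hP).
have [pilin _] := bounded_opP pi.
(* [iota x] is the sum of the tensors with one entry [x] and the others [a], over all permutations
   of the entries, obtained here by polarizing [sym_tensor]. *)
pose ax x : 'I_n -> E := dfwith (fun=> a) i0 x.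
have hiota : (fun x => polarize (@sym_tensor K n E) (ax x)) \in @bounded_op_pred K E T.
  rewrite inE; split=> [k x y|].
    exact: (polarize_multilinear n_gt0 (sym_tensor_homogeneous n_gt0 E)).
  have sc : continuous (@sym_tensor K n E) := (bounded_polyP (sym_tensor_poly n_gt0 E)).2.
  move=> x; apply: cvg_big; first exact: add_continuous.
  move=> b _; apply: cvgZr; apply: continuous_comp; last exact: sc.
  apply: cvg_big; first exact: add_continuous.
  move=> i _; apply: cvgZr; rewrite /ax.
  have [<-|ii0] := eqVneq i0 i.
    by under eq_fun do rewrite dfwithin; rewrite dfwithin; exact: cvg_id.
  by under eq_fun do rewrite dfwithout //; rewrite dfwithout //; exact: cvg_cst.
pose iota := BoundedOp hiota.
(* [N1] counts the permutations fixing [i0], which leave [x] outside the functionals; the other [N2]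
   put [a] there and [x] under one [phi]. The identity shows that [N1] is positive. *)
have [N1 [N2 [N1_gt0 piiota]]] : exists N1 N2 : nat, (0 < N1)%N /\ forall x,
    pi (iota x) = N1%:R *: x + (N2%:R * phi x) *: a.
  exists #|[set s : {ffun 'I_n -> 'I_n} | injectiveb s && (s i0 == i0)]%SET|.
  exists #|[set s : {ffun 'I_n -> 'I_n} | injectiveb s && (s i0 != i0)]%SET|.
  split.
    apply/card_gt0P; exists [ffun i => i]; rewrite inE ffunE eqxx andbT.
    by apply/injectiveP => i j; rewrite !ffunE.
  move=> x; rewrite /= (polarize_linear _ _ pilin).
  have -> : pi \o @sym_tensor K n E = P.
    by apply/funext => y; rewrite /= /pi linearize_polyE.
  rewrite (polarize_diagonal _ n_gt0 Blin).
  rewrite (bigID (fun s : {ffun 'I_n -> 'I_n} => s i0 == i0)) /=.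
  have sum_card (Q : pred {ffun 'I_n -> 'I_n}) (F : {ffun 'I_n -> 'I_n} -> E) y :
      (forall s, Q s -> F s = y) ->
      \sum_(s | Q s) F s = #|[set s | Q s]%SET|%:R *: y.
    move=> Fy; transitivity (\sum_(s in [set s | Q s]%SET) y).
      by apply: eq_big => [s|s]; [rewrite inE|exact: Fy].
    by rewrite sumr_const scaler_nat.
  congr (_ + _).
    apply: sum_card => s /andP[/injectiveP s_inj /eqP s0].
    rewrite /B /= s0 /ax dfwithin big1 ?scale1r // => j ji0.
    by rewrite dfwithout // -s0 (inj_eq s_inj) eq_sym.
  rewrite -scalerA; apply: sum_card => s /andP[/injectiveP s_inj s0].
  have sk : s (invF s_inj i0) = i0 by rewrite f_invF.
  rewrite /B /= [ax _ (s i0)]dfwithout 1?eq_sym //.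
  rewrite (bigD1 (invF s_inj i0)) /=; last first.
    by apply: contraNneq s0 => ki0; rewrite -{1}ki0 sk.
  rewrite sk /ax dfwithin big1 ?mulr1 // => j /andP[_ jk].
  by rewrite dfwithout // -[X in X != _]sk (inj_eq s_inj) eq_sym.
have N12 : N1%:R + N2%:R != 0 :> K.
  by rewrite -natrD pnatr_eq0 -lt0n addn_gt0 N1_gt0.
have N10 : N1%:R != 0 :> K by rewrite pnatr_eq0 -lt0n.
(* For [y = pi (iota x)], [phi a = 1] gives [phi y = (N1%:R + N2%:R) * phi x]. Hence [g * phi y] is
   the coefficient of [a] in [y]; removing that term and dividing by [N1] recovers [x]. *)
pose g : K := N2%:R / (N1%:R + N2%:R).
have [S SE] : exists S : bounded_op E E,
    S =1 fun y => N1%:R^-1 *: (y - (g * phi y) *: a).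
  apply: (@bounded_linear_op _ _ _ (`|N1%:R^-1| * (1 + `|g| * c * `|a|))).
  - move=> k x y.
    have -> : (k *: x + y) - (g * phi (k *: x + y)) *: a =
        k *: (x - (g * phi x) *: a) + (y - (g * phi y) *: a).
      by rewrite philin scalerBr scalerA mulrDr mulrCA scalerDl opprD addrACA.
    by rewrite scalerDr !scalerA mulrC.
  - by rewrite mulr_ge0 ?normr_ge0 // addr_ge0 // !mulr_ge0.
  move=> x; rewrite normrZ -[leRHS]mulrA ler_wpM2l //.
  apply: le_trans (ler_normB _ _) _.
  rewrite mulrDl mul1r lerD2l normrZ normrM [leRHS]mulrAC ler_wpM2r //.
  by rewrite -mulrA ler_wpM2l.
exists iota, (bounded_op_comp S pi) => x.
rewrite /= SE piiota.
have phiD y z : phi (y + z) = phi y + phi z by rewrite -[y]scale1r philin mul1r scale1r.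
have phi0 : phi 0 = 0 by apply: (@addrI _ (phi 0)); rewrite -phiD !addr0.
have phiZ k y : phi (k *: y) = k * phi y by rewrite -[k *: y]addr0 philin phi0 addr0.
rewrite phiD !phiZ phia mulr1 -mulrDl mulrA divfK //.
by rewrite addrK scalerA mulVf // scale1r.
Qed.

End Complementation.

(** * Operator ideals, linearization and the equivalences *)

Section Ideals.
Context (K : scalars).

Lemma bounded_op_eq (F G : banach K) (u v : bounded_op F G) : u =1 v -> u = v.
Proof. by move=> uv; apply/val_inj/funext. Qed.

(** The ideal property is two-sided; the left factor is taken to be the identity. *)
Lemma ideal_compr (L : operator_class K) (F G H : banach K) (v : bounded_op G H)
    (u : bounded_op F G) :
  operator_ideal L -> L G H v -> L F H (bounded_op_comp v u).
Proof.
move=> hL Lv.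
have [w wE] := bounded_linear_op (u := @id H) (fun _ _ _ => erefl) (@ler01 K)
  (fun x => eq_ind_r (fun y => _ <= y) (lexx _) (mul1r _)).
have := ideal_comp hL w u Lv.
by congr (L F H _); apply: bounded_op_eq => x; rewrite /= wE.
Qed.

Context (n : nat) (n_gt0 : (0 < n)%N) (E : banach K).

Lemma comp_sym_tensor_subproof (F : banach K)
    (u : bounded_op (sym_tensor_product n E) F) :
  u \o @sym_tensor K n E \in @bounded_poly_pred K n E F.
Proof.
have [ulin ucont] := bounded_opP u.
have [A Alin AE] := sym_tensor_homogeneous n_gt0 E.
rewrite inE; split; last first.
  move=> x; apply: continuous_comp; last exact: ucont.
  exact: (bounded_polyP (sym_tensor_poly n_gt0 E)).2.
by exists (u \o A) => [i x c y z|x]; rewrite /= ?Alin ?ulin ?AE.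
Qed.

Lemma linearize_poly_surj (F : banach K) (u : bounded_op (sym_tensor_product n E) F) :
  exists P : bounded_poly n E F, linearize_poly P = u.
Proof.
exists (BoundedPoly (comp_sym_tensor_subproof u)).
by apply: sym_tensor_product_ext => x; rewrite linearize_polyE.
Qed.

(** A factorization [P = u \o Q] linearizes to one of the operator through [linearize_poly Q].
    Conversely, [P] is its linearization after the canonical polynomial [sym_tensor_poly]. *)
Lemma ideal_polyP (L : operator_class K) (F : banach K) (P : bounded_poly n E F) :
  operator_ideal L -> ideal_poly L P <-> L _ _ (linearize_poly P).
Proof.
move=> hL; split=> [[G [Q [u [Lu PE]]]]|LP].
  rewrite (_ : linearize_poly P = bounded_op_comp u (linearize_poly Q)).
    exact: ideal_compr.
  by apply: sym_tensor_product_ext => x; rewrite /= !linearize_polyE.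
exists (sym_tensor_product n E), (sym_tensor_poly n_gt0 E), (linearize_poly P).
by split=> // x; rewrite linearize_polyE.
Qed.

End Ideals.

Theorem theorem4p10 (K : scalars) (I J : operator_class K)
    (hI : operator_ideal I) (hJ : operator_ideal J)
    (C : banach K -> Prop) (tau : topologies K)
    (htau : projective_ideal_topology C tau)
    (n : nat) (hn : (0 < n)%N) (E : banach K) (hE : C E) :
  let T := sym_tensor_product n E in
  let cond_a := WAP I J tau T in
  let cond_b := @ideal_poly K I n E T `<=`
    closure_in (poly_top tau n E T) (@ideal_poly K J n E T) in
  let cond_c := I E T `<=` closure_in (op_top tau E T) (J E T) in
  (cond_a <-> cond_b) /\ (cond_a -> cond_c).
Proof.
move=> T cond_a cond_b cond_c.
have [lin_cont lin_open] := projective_poly htau T hn hE.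
split; [split|].
- move=> a P /(ideal_polyP hn _ hI)/a clP U.
  rewrite nbhsE => -[V [Vopen VP] VU].
  (* Openness of linearization makes this image a neighbourhood of the linearized [P], so it meets
     [J]. *)
  have [] := clP (@linearize_poly K n E T @` V).
    apply: open_nbhs_nbhs; split; last by exists P.
    exact: lin_open.
  move=> u [Ju [Q VQ Qu]]; exists Q; split; last exact: VU.
  by apply/(ideal_polyP hn _ hJ); rewrite Qu.
- move=> b u Iu U nU; have [P PE] := linearize_poly_surj hn u.
  have /b clP : ideal_poly I P by apply/(ideal_polyP hn _ hI); rewrite PE.
  (* Continuity of linearization makes the preimage of [U] a neighbourhood of [P]. *)
  have [|Q [/(ideal_polyP hn _ hJ) JQ UQ]] := clP (@linearize_poly K n E T @^-1` U).
    by apply: lin_cont; rewrite PE.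
  by exists (linearize_poly Q).
move=> a v Iv; have [iota [rho rhoK]] := sym_tensor_complemented hn E.
(* The closure of [J] is again an operator ideal, so composing [v \o rho] with [iota] on the right
   stays in it. *)
have := ideal_compr iota (projective_ideal htau hJ) (a _ (ideal_compr rho hI Iv)).
by congr (closure_class _ _ _); apply: bounded_op_eq => x /=; rewrite rhoK.
Qed.
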